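(* Let $\{X(t), t\ge 0\}$ be the queue-length process with catastrophes described in the context. Suppose that for some sequence of positive numbers $\{d_k,\ k\ge 0\}$ with $d=\inf_{k\ge 0}d_k>0$ there exist positive constants $R_{**}$ and $b_{**}$ such that the function $\beta_{**}(t)$ built from $\{d_k\}$ (see context) satisfies $$e^{-\int_s^t\beta_{**}(\tau)\,d\tau}\le R_{**}e^{-b_{**}(t-s)}\qquad\text{for any } 0\le s\le t,$$ and that the common catastrophe rate $\beta_*(t)=\inf_{i\ge 1}\beta_i(t)$ is bounded: $$\beta_*(t)\le b^*<\infty\qquad\text{for almost all } t\ge 0 .$$ Then the limiting regime of $X(t)$ (which exists, $X(t)$ being exponentially weakly ergodic under the first condition) satisfies the bound $$\limsup_{t\to\infty}\|\mathbf p(t)\|_{1D}\le\frac{R_{**}\,d_0\,b^*}{b_{**}},$$ where $\mathbf p(t)$ is the vector of state probabilities of $X(t)$.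
   Context: Model. $X(t)$ is a (generally time-inhomogeneous) continuous-time Markov chain on $\{0,1,2,\dots\}$ with intensity matrix $Q(t)=(q_{ij}(t))_{i,j\ge 0}$: $q_{ij}(t)=\lambda_{ij}(t)$ for $j>i$ (intensity of arrival of a group of $j-i$ customers); $q_{ij}(t)=\mu_{ij}(t)$ for $1\le j<i$ (intensity of service of a group of $i-j$ customers); $q_{i0}(t)=\mu_{i0}(t)+\beta_i(t)$ for $i\ge 1$, where $\mu_{i0}(t)$ is a service intensity and $\beta_i(t)$ is the catastrophe intensity (simultaneous loss of all customers) in state $i$; and the $q_{ii}(t)$ are such that all row sums are zero. Standing assumptions. All intensity functions $q_{ij}(t)$ are locally integrable on $[0,\infty)$, and $\sup_i|q_{ii}(t)|=L(t)<\infty$ for almost all $t\ge 0$; the operator function $A(t)=Q^T(t)$ from $l_1$ into itself is bounded for almost all $t\ge 0$ and locally integrable on $[0,\infty)$. Notation. $\|\mathbf z\|=\sum_k|z_k|$ is the $l_1$-norm. The vector of state probabilities is $\mathbf p(t)=(p_0(t),p_1(t),\dots)^T$, $p_i(t)=P\{X(t)=i\}$; it solves the forward Kolmogorov system $\frac{d\mathbf p(t)}{dt}=A(t)\mathbf p(t)$ in $l_1$, with initial condition the initial probability distribution $\mathbf p(0)$ of $X(t)$. The chain is weakly ergodic if $\|\mathbf p^{*}(t)-\mathbf p^{**}(t)\|\to 0$ as $t\to\infty$ for any two solutions with any initial conditions $\mathbf p^{*}(0)$, $\mathbf p^{**}(0)$, and exponentially weakly ergodic if this difference tends to zero exponentially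 fast. With $D=\mathrm{diag}(d_0,d_1,\dots)$, put $\|\mathbf z\|_{1D}=\|D\mathbf z\|=\sum_k d_k|z_k|$. Define $A^*(t)=(a^*_{ij}(t))_{i,j\ge 0}$ by $a^*_{00}(t)=q_{00}(t)-\beta_*(t)$; $a^*_{0j}(t)=\mu_{j0}(t)+\beta_j(t)-\beta_*(t)$ for $j\ge 1$; and $a^*_{ij}(t)=q_{ji}(t)$ otherwise. Let $A^*_D(t)=DA^*(t)D^{-1}$, with entries $a^*_{i,j,D}(t)=d_i\,a^*_{ij}(t)/d_j$, and $$\beta_{**}(t)=\inf_{i}\Big(|a^*_{i,i,D}(t)|-\sum_{j\ne i}a^*_{j,i,D}(t)\Big).$$
   Formalization: The limsup bound is stated only for initial distributions with finite weighted norm ‖p(0)‖_{1D}; if this norm is infinite (possible when d_k is unbounded), ‖p(t)‖_{1D} is infinite for every t and the bound fails. *)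

(* Defs.v *)
From HB Require Import structures.
From mathcomp Require Import all_boot all_order all_algebra.
From mathcomp Require Import all_classical all_reals all_analysis.

Set Implicit Arguments.
Unset Strict Implicit.
Unset Printing Implicit Defensive.

Import Order.TTheory GRing.Theory Num.Theory.
Import numFieldNormedType.Exports.

Local Open Scope classical_set_scope.
Local Open Scope ring_scope.

Section sequence_spaces.
Context {R : realType}.
Implicit Types (z dk : nat -> R) (a : nat -> nat -> R).

Definition l1_norm z : \bar R := (\sum_(0 <= k <oo) (`|z k|)%:E)%E.

Definition l1D_norm dk z : \bar R := l1_norm (fun k => dk k * z k).

(* An infinite matrix acting on a column vector.  The limit is meaningful
   when the i-th series converges, in particular for z in l_1 and a matrix of
   finite operator norm. *)
Definition l1_apply a z : nat -> R :=
  fun i => limn (series (fun j => a i j * z j)).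

(* Divergent series cannot make this supremum spuriously finite: the images
   of the basis vectors are the columns of a, so a finite value bounds the
   l_1-norms of the columns, and then all the series in l1_apply converge
   absolutely on l_1. *)
Definition l1_opnorm a : \bar R :=
  ereal_sup [set l1_norm (l1_apply a z) | z in [set z | (l1_norm z <= 1)%E]].

Definition prob_vector z : Prop :=
  (forall k, 0 <= z k) /\ series z @ \oo --> (1 : R).

End sequence_spaces.

Section queue.
Context {R : realType}.

Notation leb := (@lebesgue_measure R).

Definition loc_integrable (f : R -> R) : Prop :=
  forall u : R, 0 <= u -> leb.-integrable `[0, u] (EFin \o f).

(* lam i j is used only for i < j, mu i j only for j < i, beta i only for
   1 <= i. *)
Definition queue_intensities (lam mu : nat -> nat -> R -> R)
    (beta : nat -> R -> R) (q : nat -> nat -> R -> R) : Prop :=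
  forall t : R, 0 <= t ->
  [/\ (forall i j, (i < j)%N -> 0 <= lam i j t) /\
      (forall i j, (j < i)%N -> 0 <= mu i j t) /\
      (forall i, (1 <= i)%N -> 0 <= beta i t),
      forall i j, (i < j)%N -> q i j t = lam i j t,
      forall i j, (1 <= j < i)%N -> q i j t = mu i j t,
      forall i, (1 <= i)%N -> q i 0%N t = mu i 0%N t + beta i t
    & forall i, series (fun j => q i j t) @ \oo --> (0 : R)].

Definition forward_op (q : nat -> nat -> R -> R) (t : R) : nat -> nat -> R :=
  fun i j => q j i t.

(* The local integrability of each beta i has to be listed: that of
   q_i0 = mu_i0 + beta_i does not give the measurability of the summands. *)
Definition standing_assumptions (beta : nat -> R -> R)
    (q : nat -> nat -> R -> R) : Prop :=
  [/\ (forall i j, loc_integrable (q i j)) /\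
      (forall i, (1 <= i)%N -> loc_integrable (beta i)),
      {ae leb, forall t, 0 <= t ->
        (ereal_sup (range (fun i => (`|q i i t|)%:E)) < +oo)%E},
      {ae leb, forall t, 0 <= t -> (l1_opnorm (forward_op q t) < +oo)%E}
    & forall u : R, 0 <= u ->
        leb.-integrable `[0, u] (fun t => l1_opnorm (forward_op q t))].

(* Solutions of dp/dt = A(t) p in l_1 on [s, +oo[.  As A is only locally
   integrable, the equation is understood in the Caratheodory sense: p is
   continuous in l_1 and p(t) = p(s) + \int_s^t A(tau) p(tau) dtau.  The
   Bochner integral of an l_1-valued function is computed coordinatewise. *)
Definition forward_solution (q : nat -> nat -> R -> R) (s : R)
    (p : R -> nat -> R) : Prop :=
  [/\ forall t, s <= t -> (l1_norm (p t) < +oo)%E,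
      forall t0, s <= t0 ->
        l1_norm (fun k => p t k - p t0 k)
          @[t --> within [set t | s <= t] (nbhs t0)] --> (0 : \bar R)%E
    & forall t i, s <= t ->
        leb.-integrable `[s, t]
          (EFin \o (fun tau => l1_apply (forward_op q tau) (p tau) i)) /\
        p t i = p s i +
          \int[leb]_(tau in `[s, t]) l1_apply (forward_op q tau) (p tau) i].

Definition exp_weakly_ergodic (q : nat -> nat -> R -> R) : Prop :=
  forall p1 p2 : R -> nat -> R,
    forward_solution q 0 p1 -> prob_vector (p1 0) ->
    forward_solution q 0 p2 -> prob_vector (p2 0) ->
    exists C a : R, [/\ 0 < C, 0 < a &
      forall t, 0 <= t ->
        (l1_norm (fun k => p1 t k - p2 t k)%R <= (C * expR (- (a * t)))%:E)%E].

Definition state_prob d (T : measurableType d) (P : probability T R)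
    (X : R -> {RV P >-> nat}) (t : R) : nat -> R :=
  fun i => fine (P (X t @^-1` [set i])).

(* Pi s t i j is the transition probability from state i at time s to state j
   at time t; only times 0 <= s <= t matter. *)
Definition markov_chain_with_intensities d (T : measurableType d)
    (P : probability T R) (X : R -> {RV P >-> nat})
    (q : nat -> nat -> R -> R) : Prop :=
  exists Pi : R -> R -> nat -> nat -> R,
  [/\ forall s t i, 0 <= s <= t -> prob_vector (Pi s t i),
      forall (n : nat) (t : nat -> R) (i : nat -> nat),
        0 <= t 0%N -> (forall k, (k <= n)%N -> t k < t k.+1) ->
        P (\bigcap_(k in [set k | (k <= n.+1)%N]) (X (t k) @^-1` [set i k])) =
        (P (\bigcap_(k in [set k | (k <= n)%N]) (X (t k) @^-1` [set i k])) *
         (Pi (t n) (t n.+1) (i n) (i n.+1))%:E)%E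
    & forall s i, 0 <= s ->
        forward_solution q s (fun t => Pi s t i) /\
        forall j, Pi s s i j = (i == j)%:R].

Definition beta_star (beta : nat -> R -> R) (t : R) : R :=
  inf [set beta i t | i in [set i | (1 <= i)%N]].

Definition a_star (mu : nat -> nat -> R -> R) (beta : nat -> R -> R)
    (q : nat -> nat -> R -> R) (t : R) (i j : nat) : R :=
  if i == 0%N then
    if j == 0%N then q 0%N 0%N t - beta_star beta t
    else mu j 0%N t + beta j t - beta_star beta t
  else q j i t.

Definition a_starD (dk : nat -> R) (mu : nat -> nat -> R -> R)
    (beta : nat -> R -> R) (q : nat -> nat -> R -> R) (t : R) (i j : nat) : R :=
  dk i * a_star mu beta q t i j / dk j.

(* Extended-real valued: the series of nonnegative off-diagonal entries of a
   column may be infinite, and the infimum may be -oo. *)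
Definition beta_sstar (dk : nat -> R) (mu : nat -> nat -> R -> R)
    (beta : nat -> R -> R) (q : nat -> nat -> R -> R) (t : R) : \bar R :=
  ereal_inf (range (fun i =>
    ((`|a_starD dk mu beta q t i i|)%:E -
      \sum_(0 <= j <oo | j != i) (a_starD dk mu beta q t j i)%:E)%E)).

End queue.

(* Main.v *)
(* The key is that the decay hypothesis, stated for the weights d_k, passes to
   the truncated weights w_k = min(d_k, M).  Choosing columns whose weight is
   close to inf d shows beta_** <= beta_* almost everywhere, and then
   sum_i w_i a*_ij <= - beta_** w_j for every column j: by definition of
   beta_** if d_j <= M, and because the columns of A* sum to - beta_* if
   d_j > M.  As the w_k are bounded, no a priori finiteness of the weighted
   norm is needed.

   A solution z satisfies z' = A* z + beta_* (sum z) e_0.  Keeping the first n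
   coordinates gives a finite cooperative system whose error is at most
   w_0 beta_* |sum z| + 2 M K rho_n, with K the operator norm of A and rho_n
   the tail of the l_1-norm of z.  Gronwall's inequality, dominated convergence
   as n -> oo and then M -> oo yield, when |beta_* sum z| <= c,
   |z(t)|_1D <= R e^(-b t) |z(0)|_1D + R d_0 c / b.  The difference of two
   solutions with equal mass has c = 0 (with M = inf d, weighted norms are
   multiples of the l_1-norm: ergodicity); a probability vector has c = b^*.

   With merely integrable coefficients, Gronwall's inequality is proved without
   differentiation: increments over short intervals are compared up to an error
   quadratic in the integral of a dominating function. *)
Require Import Defs.
From HB Require Import structures.
From mathcomp Require Import all_boot all_order all_algebra.
From mathcomp Require Import all_classical all_reals all_analysis.
From mathcomp Require Import measurable_realfun lra ring.
Import Order.TTheory GRing.Theory Num.Theory.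
Import numFieldNormedType.Exports.
Local Open Scope classical_set_scope.
Local Open Scope ring_scope.

Set Implicit Arguments.
Unset Strict Implicit.
Unset Printing Implicit Defensive.

(** * Integrals and Gronwall-type inequalities *)

Section real_integral.
Context {R : realType}.
Notation leb := (@lebesgue_measure R).
Implicit Types (f g m : R -> R) (a b s t : R).

Lemma integrable_subitv f a b s t : a <= s -> t <= b ->
  leb.-integrable `[a, b] (EFin \o f) -> leb.-integrable `[s, t] (EFin \o f).
Proof.
move=> as_ tb; apply: integrableS => //.
by apply: subset_itv; rewrite bnd_simp.
Qed.

Lemma Rintegral_itv_cat f a s b : a <= s -> s <= b ->
  leb.-integrable `[a, b] (EFin \o f) ->
  \int[leb]_(x in `[a, b]) f x =
  \int[leb]_(x in `[a, s]) f x + \int[leb]_(x in `[s, b]) f x.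
Proof.
move=> as_ sb fi; apply/eqP; rewrite addrC -subr_eq; apply/eqP.
rewrite Rintegral_itvB ?bnd_simp//.
rewrite Rintegral_itv_obnd_cbnd//.
apply: integrableS fi => //; apply: subset_itv; rewrite bnd_simp//.
Qed.

Lemma ae_imply d (T : measurableType d) (mu : {measure set T -> \bar R})
    (P Q : T -> Prop) : (forall x, P x -> Q x) ->
  {ae mu, forall x, P x} -> {ae mu, forall x, Q x}.
Proof. by move=> PQ; apply: filterS. Qed.

Lemma ae_and d (T : measurableType d) (mu : {measure set T -> \bar R})
    (P Q : T -> Prop) : {ae mu, forall x, P x} -> {ae mu, forall x, Q x} ->
  {ae mu, forall x, P x /\ Q x}.
Proof. exact: filterI. Qed.

Lemma integrable_EFinZl d (T : measurableType d) (mu : {measure set T -> \bar R})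
    (D : set T) (c : R) (f : T -> R) : measurable D ->
  mu.-integrable D (EFin \o f) ->
  mu.-integrable D (EFin \o (fun x => c * f x)).
Proof. by move=> mD fi; exact: (integrableZl mD c fi). Qed.

Lemma integrable_EFinD d (T : measurableType d) (mu : {measure set T -> \bar R})
    (D : set T) (f g : T -> R) : measurable D ->
  mu.-integrable D (EFin \o f) -> mu.-integrable D (EFin \o g) ->
  mu.-integrable D (EFin \o (fun x => f x + g x)).
Proof. by move=> mD fi gi; exact: (integrableD mD fi gi). Qed.

Lemma integrable_EFinB d (T : measurableType d) (mu : {measure set T -> \bar R})
    (D : set T) (f g : T -> R) : measurable D ->
  mu.-integrable D (EFin \o f) -> mu.-integrable D (EFin \o g) ->
  mu.-integrable D (EFin \o (fun x => f x - g x)).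
Proof. by move=> mD fi gi; exact: (integrableB mD fi gi). Qed.

(** As the inequality holds only almost everywhere, [g - f] is replaced by its positive part, which
    has the same integral and is nonnegative everywhere. *)
Lemma ae_le_Rintegral d (T : measurableType d) (mu : {measure set T -> \bar R})
    (D : set T) (f g : T -> R) : measurable D ->
  mu.-integrable D (EFin \o f) -> mu.-integrable D (EFin \o g) ->
  {ae mu, forall x, D x -> f x <= g x} ->
  \int[mu]_(x in D) f x <= \int[mu]_(x in D) g x.
Proof.
move=> mD fi gi fg; rewrite -subr_ge0 -RintegralB//.
have mh : measurable_fun D (fun x => g x - f x).
  by apply: measurable_funB; apply/measurable_EFinP; apply: measurable_int;
    [exact: gi|exact: fi].
rewrite [leRHS](_ : _ = \int[mu]_(x in D) Num.max (g x - f x) 0).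
  by apply: Rintegral_ge0 => x _; rewrite le_max lexx orbT.
congr fine; apply: ae_eq_integral => //.
- exact/measurable_EFinP.
- by apply/measurable_EFinP/measurable_maxr.
- apply: filterS fg => x fg Dx; congr EFin.
  by apply/esym/max_idPl; rewrite subr_ge0 fg.
Qed.

(** Absolute continuity of the integral, applied to [m] extended by zero outside [[a, b]]. *)
Lemma Rintegral_itv_small m a b : leb.-integrable `[a, b] (EFin \o m) ->
  forall e, 0 < e -> exists2 d, 0 < d & forall s t, a <= s -> s <= t -> t <= b ->
    t - s < d -> \int[leb]_(x in `[s, t]) `|m x| < e.
Proof.
move=> mi e e0.
have mi' : leb.-integrable setT (EFin \o (m \_ `[a, b])).
  rewrite -restrict_EFin.
  exact/(integrable_mkcond (mu := leb) (EFin \o m) (measurable_itv `[a, b])).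
have [d [d0 dP]] := integral_normr_continuous mi' e0.
exists d => // s t as_ st tb tsd.
have mst : (leb `[s, t]%classic < d%:E)%E.
  rewrite lebesgue_measure_itv/= lte_fin -EFinB.
  by move: st; rewrite le_eqVlt => /orP[/eqP->|->]; rewrite ?ltxx// lte_fin.
apply: le_lt_trans (dP _ (measurable_itv _) mst).
rewrite le_eqVlt; apply/orP; left; apply/eqP.
apply: eq_Rintegral => x; rewrite inE/= in_itv/= => /andP[sx xt].
rewrite patchE ifT// inE/= in_itv/= (le_trans as_ sx)/=.
exact: le_trans xt tb.
Qed.

(** Over a uniform partition, the squared increments of [M] sum to at most the largest increment
    times [M b - M a], which vanishes with the mesh. This takes the place of differentiating [F]. *)
Lemma telescope_quadratic_le (F M : R -> R) (C a b : R) : a <= b -> 0 <= C ->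
  (forall s t, a <= s -> s <= t -> t <= b -> M s <= M t) ->
  (forall e, 0 < e -> exists2 d, 0 < d & forall s t,
    a <= s -> s <= t -> t <= b -> t - s < d -> M t - M s < e) ->
  (forall s t, a <= s -> s <= t -> t <= b -> M t - M s <= 2^-1 ->
    F t - F s <= C * (M t - M s) ^+ 2) ->
  F b <= F a.
Proof.
move=> ab C0 Mnd Mc FM.
apply/ler_addgt0Pr => e e0.
have den : 0 < C * (M b - M a) + 1.
  by rewrite ltr_wpDl// mulr_ge0// subr_ge0 Mnd.
(* The value 1/2 makes the quadratic estimate applicable on each step; the other value makes the
   total error [C * e' * (M b - M a)] at most [e], the added 1 keeping the denominator positive. *)
pose e' := Num.min 2^-1 (e / (C * (M b - M a) + 1)).
have e'0 : 0 < e' by rewrite lt_min invr_gt0 ltr0n divr_gt0.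
have [d d0 dP] := Mc _ e'0.
have [n nP] : exists n : nat, (b - a) / n.+1%:R < d.
  exists (Num.truncn ((b - a) / d)).
  rewrite ltr_pdivrMr// mulrC -ltr_pdivrMr//.
  exact: truncnS_gt.
pose u (k : nat) := a + k%:R * ((b - a) / n.+1%:R).
have h0 : 0 <= (b - a) / n.+1%:R by rewrite divr_ge0// subr_ge0.
have u0 k : a <= u k by rewrite lerDl mulr_ge0.
have uS k : u k <= u k.+1 by rewrite lerD2l ler_wpM2r// ler_nat.
have ub k : (k <= n.+1)%N -> u k <= b.
  move=> kn; rewrite /u -lerBrDl mulrCA ler_piMr ?subr_ge0//.
  by rewrite ler_pdivrMr// mul1r ler_nat.
have uSB k : u k.+1 - u k < d.
  by rewrite /u opprD addrACA subrr add0r -mulrBl -natrB// subSnn mul1r.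
have step k : (k <= n.+1)%N -> F (u k) - F a <= C * e' * (M (u k) - M a).
  elim: k => [|k ih] kn; first by rewrite /u mul0r addr0 !subrr mulr0.
  have kn' : (k <= n.+1)%N by exact: ltnW.
  have := ih kn'.
  have Mk := dP _ _ (u0 k) (uS k) (ub _ kn) (uSB k).
  have M0 := Mnd _ _ (u0 k) (uS k) (ub _ kn).
  have := FM _ _ (u0 k) (uS k) (ub _ kn) _.
  have Me1 : M (u k.+1) - M (u k) <= 2^-1.
    by rewrite (le_trans (ltW Mk))// ge_min lexx.
  move=> /(_ Me1) H1 H2.
  have H3 : C * (M (u k.+1) - M (u k)) ^+ 2 <= C * e' * (M (u k.+1) - M (u k)).
    rewrite expr2 -mulrA ler_wpM2l// ler_wpM2r ?subr_ge0//.
    exact: ltW.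
  have -> : F (u k.+1) - F a = (F (u k.+1) - F (u k)) + (F (u k) - F a) by ring.
  have -> : M (u k.+1) - M a = (M (u k.+1) - M (u k)) + (M (u k) - M a) by ring.
  rewrite mulrDr lerD//; exact: le_trans H3.
have := step n.+1 (leqnn _).
have -> : u n.+1 = b by rewrite /u mulrC divfK ?pnatr_eq0// addrC subrK.
move=> H; rewrite -lerBlDl (le_trans H)//.
apply: (@le_trans _ _ ((C * (M b - M a) + 1) * e')).
  by rewrite mulrAC ler_wpM2r ?(ltW e'0)// lerDl.
rewrite mulrC -ler_pdivlMr// ge_min lexx orbT//.
Qed.

(** Inverting [1 - x <= expR (- x)] gives [expR x <= (1 - x)^-1], and
    [(1 + x + 2 * x ^+ 2) * (1 - x)] is at least 1 when [x <= 2^-1], however negative [x] may be. *)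
Lemma expR_le_quadratic (x : R) : x <= 2^-1 -> expR x <= 1 + x + 2 * x ^+ 2.
Proof.
move=> x2; have := expR_ge1Dx (- x); rewrite expRN => H.
have x1 : 0 < 1 - x by lra.
have : expR x <= (1 - x)^-1.
  by rewrite -[leLHS]invrK lef_pV2// posrE ?invr_gt0 ?expR_gt0.
move=> /le_trans; apply; rewrite -[leLHS]mul1r ler_pdivrMr//.
have -> : (1 + x + 2 * x ^+ 2) * (1 - x) = 1 + x ^+ 2 * (1 - 2 * x) by ring.
by rewrite lerDl mulr_ge0 ?sqr_ge0//; lra.
Qed.

End real_integral.

(** * Gronwall's inequality for finite cooperative systems *)

Section cooperative.
Context {R : realType}.
Notation leb := (@lebesgue_measure R).

Lemma Rintegral_sum (I : Type) (r : seq I) (D : set R) (c : I -> R)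
    (f : I -> R -> R) : measurable D ->
  (forall i, leb.-integrable D (EFin \o f i)) ->
  leb.-integrable D (EFin \o (fun x => \sum_(i <- r) c i * f i x)) /\
  \int[leb]_(x in D) (\sum_(i <- r) c i * f i x) =
    \sum_(i <- r) c i * \int[leb]_(x in D) f i x.
Proof.
move=> mD fi; elim: r => [|i r [ih1 ih2]].
  rewrite big_nil; split.
    under eq_fun do rewrite big_nil.
    exact: integrable0.
  under eq_Rintegral do rewrite big_nil.
  by rewrite Rintegral_cst// mul0r.
have ci : leb.-integrable D (EFin \o (fun x => c i * f i x)).
  exact: integrable_EFinZl.
split.
  under eq_fun do rewrite big_cons.
  exact: integrable_EFinD.
under eq_Rintegral do rewrite big_cons.
by rewrite big_cons RintegralD// ih2 RintegralZl.
Qed.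

(* Backward Euler: taking the signs at the end point y bounds the diagonal
   terms without any smallness condition on the step. *)
Lemma cooperative_step (N : nat) (w x y f : nat -> R) (a : nat -> nat -> R)
    (g J eta m : R) : (forall i, 0 <= w i) ->
  (forall i j, (i < N)%N -> (j < N)%N -> i != j -> 0 <= a i j) ->
  (forall j, (j < N)%N -> \sum_(i < N) w i * a i j <= - g * w j) ->
  \sum_(i < N) \sum_(j < N) w i * `|a i j| <= m ->
  \sum_(i < N) w i * `|f i - \sum_(j < N) a i j * x j| <= eta ->
  (forall j, (j < N)%N -> `|x j - y j| <= J) -> 0 <= J ->
  \sum_(i < N) (w i * Num.sg (y i)) * f i <=
    - g * (\sum_(i < N) w i * `|y i|) + J * m + eta.
Proof.
move=> w0 a0 aw am fa xy J0.
have sg1 (u v : R) : Num.sg u * v <= `|v|.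
  rewrite (le_trans (ler_norm _))// normrM normr_sg ler_piMl//.
  by case: (u != 0).
apply: (@le_trans _ _ (\sum_(i < N) (w i * `|f i - \sum_(j < N) a i j * x j| +
    w i * (\sum_(j < N) (a i j * `|y j| + `|a i j| * J))))).
  apply: ler_sum => i _; rewrite -mulrA -mulrDr ler_wpM2l//.
  rewrite -{1}(subrK (\sum_(j < N) a i j * x j) (f i)) mulrDr lerD//.
  rewrite mulr_sumr; apply: ler_sum => j _.
  rewrite -{1}(subrK (y j) (x j)) mulrDr mulrDr addrC lerD//.
    have [->|ij] := eqVneq j i.
      by rewrite mulrCA -normrEsg.
    by rewrite mulrCA ler_wpM2l ?a0// eq_sym.
  rewrite (le_trans (sg1 _ _))// normrM ler_wpM2l// xy//.
rewrite big_split/= addrC lerD//.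
under eq_bigr do rewrite big_split/= mulrDr.
rewrite big_split/= lerD//.
  under eq_bigr do rewrite mulr_sumr.
  rewrite exchange_big/= mulr_sumr; apply: ler_sum => j _.
  under eq_bigr do rewrite mulrA.
  by rewrite -mulr_suml mulrA ler_wpM2r// aw.
apply: le_trans (ler_wpM2l J0 am); rewrite mulr_sumr le_eqVlt; apply/orP; left.
apply/eqP; apply: eq_bigr => i _; rewrite !mulr_sumr; apply: eq_bigr => j _.
by rewrite mulrA mulrC.
Qed.

(** Formally the weighted norm W satisfies W' <= - g W + eta, so e^G W minus the integral of e^G eta
    does not increase. The single function [m] dominates all the data, and its integral measures the
    length of the steps. The matrix is chosen separately at each [x], so no regularity in [x] is
    asked of it. *)
Lemma cooperative_gronwall (N : nat) (T : R) (w : nat -> R) (z f : R -> nat -> R)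
    (g eta m : R -> R) : 0 <= T -> (forall i, 0 <= w i) ->
  (forall i, leb.-integrable `[0, T] (EFin \o f ^~ i)) ->
  (forall i t, 0 <= t -> t <= T ->
    z t i = z 0 i + \int[leb]_(x in `[0, t]) f x i) ->
  leb.-integrable `[0, T] (EFin \o g) ->
  leb.-integrable `[0, T] (EFin \o eta) ->
  leb.-integrable `[0, T] (EFin \o m) ->
  (forall x, 0 <= eta x) ->
  (forall x, `|g x| <= m x) -> (forall x, eta x <= m x) ->
  (forall x i, (i < N)%N -> `|f x i| <= m x) ->
  {ae leb, forall x, `[0, T]%classic x -> exists a : nat -> nat -> R, [/\
    forall i j, (i < N)%N -> (j < N)%N -> i != j -> 0 <= a i j,
    forall j, (j < N)%N -> \sum_(i < N) w i * a i j <= - g x * w j,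
    \sum_(i < N) \sum_(j < N) w i * `|a i j| <= m x &
    \sum_(i < N) w i * `|f x i - \sum_(j < N) a i j * z x j| <= eta x]} ->
  let G t := \int[leb]_(x in `[0, t]) g x in
  leb.-integrable `[0, T] (EFin \o (fun x => expR (G x) * eta x)) /\
  expR (G T) * (\sum_(i < N) w i * `|z T i|) <=
    \sum_(i < N) w i * `|z 0 i| +
    \int[leb]_(x in `[0, T]) (expR (G x) * eta x).
Proof.
move=> T0 w0 fi zE gi etai mi eta0 gm etam fm coop G.
have m0 x : 0 <= m x by rewrite (le_trans _ (gm x)).
pose M t := \int[leb]_(x in `[0, t]) m x.
have sub (h : R -> R) s t : 0 <= s -> t <= T ->
  leb.-integrable `[0, T] (EFin \o h) -> leb.-integrable `[s, t] (EFin \o h).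
  exact: integrable_subitv.
have incr (h : R -> R) s t : 0 <= s -> s <= t -> t <= T ->
    leb.-integrable `[0, T] (EFin \o h) ->
    \int[leb]_(x in `[0, t]) h x - \int[leb]_(x in `[0, s]) h x =
    \int[leb]_(x in `[s, t]) h x.
  move=> s0 st tT hi; rewrite (@Rintegral_itv_cat _ h 0 s t)//.
    by rewrite addrC addKr.
  exact: sub.
have Mnd s t : 0 <= s -> s <= t -> t <= T -> M s <= M t.
  by move=> *; rewrite -subr_ge0 incr// Rintegral_ge0.
have absle (h : R -> R) s t : 0 <= s -> s <= t -> t <= T ->
    leb.-integrable `[0, T] (EFin \o h) -> (forall x, `|h x| <= m x) ->
    `|\int[leb]_(x in `[s, t]) h x| <= M t - M s.
  move=> s0 st tT hi hm; rewrite incr//.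
  apply: (le_trans (le_normr_Rintegral _ _)) => //; first exact: sub.
  apply: le_Rintegral => //; [|exact: sub].
  by apply: integrable_norm; exact: sub.
have M00 : M 0 = 0 by rewrite /M set_itv1 Rintegral_set1.
have G00 : G 0 = 0 by rewrite /G set_itv1 Rintegral_set1.
have GM t : 0 <= t -> t <= T -> `|G t| <= M T.
  move=> t0 tT; rewrite (le_trans _ (Mnd _ _ t0 tT _))//.
  by have := absle g 0 t; rewrite M00 subr0; apply.
have Gmeas : measurable_fun `[0, T] (fun x => expR (G x)).
  apply: measurableT_comp => //.
  apply: subspace_continuous_measurable_fun => //.
  exact: parameterized_integral_continuous.
have Gbnd : [bounded expR (G x) | x in `[0, T]%classic].
  exists (expR (M T)); split; first exact: num_real.
  move=> y My x /=; rewrite in_itv/= => /andP[x0 xT].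
  rewrite ger0_norm ?expR_ge0// (le_trans _ (ltW My))// ler_expR.
  by rewrite (le_trans (ler_norm _))// GM.
have Eint : leb.-integrable `[0, T] (EFin \o (fun x => expR (G x) * eta x)).
  have mT : measurable (`[0, T]%classic : set R) by [].
  exact: (@integrableMr _ _ R leb _ mT _ (EFin \o eta) Gmeas Gbnd etai).
split => //.
pose W t := \sum_(i < N) w i * `|z t i|.
pose E t := \int[leb]_(x in `[0, t]) (expR (G x) * eta x).
pose Bw := \sum_(i < N) w i * (`|z 0 i| + M T).
have W0 t : 0 <= W t by apply: sumr_ge0 => i _; rewrite mulr_ge0.
have zincr i s t : (i < N)%N -> 0 <= s -> s <= t -> t <= T ->
    `|z t i - z s i| <= M t - M s.
  move=> iN s0 st tT; rewrite (zE i t)// ?(zE i s)//; [|exact: le_trans tT|exact: le_trans st].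
  rewrite opprD addrACA subrr add0r incr//.
  rewrite (incr m)//; apply: (le_trans (le_normr_Rintegral _ _)) => //.
    exact: sub.
  apply: le_Rintegral => //; [|exact: sub|by move=> x _; exact: fm].
  by apply: integrable_norm; exact: sub.
(* This crude uniform bound only enters the constant in front of second-order terms. *)
have WB t : 0 <= t -> t <= T -> W t <= Bw.
  move=> t0 tT; apply: ler_sum => i _; rewrite ler_wpM2l//.
  rewrite -[z t i](subrK (z 0 i)) addrC (le_trans (ler_normD _ _))// lerD2l.
  rewrite (le_trans (zincr _ _ _ _ (lexx 0) t0 tT))// M00 subr0.
  exact: Mnd.
have Bw0 : 0 <= Bw by rewrite (le_trans (W0 0))// WB.
(* The differential inequality integrated over one step; the square is the cost of replacing [z x]
   by [z t] under the integral. *)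
have key s t : 0 <= s -> s <= t -> t <= T ->
    W t * (1 + (G t - G s)) <=
    W s + (M t - M s) ^+ 2 + \int[leb]_(x in `[s, t]) eta x.
  move=> s0 st tT.
  have t0 : 0 <= t by exact: le_trans st.
  have sT : s <= T by exact: le_trans tT.
  have fi' (i : 'I_N) : leb.-integrable `[s, t] (EFin \o f ^~ i).
    exact: sub.
  have [hi hE] := Rintegral_sum (index_enum 'I_N)
    (fun i => w i * Num.sg (z t i)) (measurable_itv _) fi'.
  (* Convexity of the absolute value: with the signs frozen at the end point [t], the increment of W
     is bounded by a linear functional of the increment of [z]. *)
  have H1 : W t - W s <=
      \int[leb]_(x in `[s, t]) (\sum_(i < N) w i * Num.sg (z t i) * f x i).
    rewrite hE -sumrB; apply: ler_sum => i _.
    rewrite -mulrBr -mulrA ler_wpM2l//.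
    have -> : \int[leb]_(x in `[s, t]) f x i = z t i - z s i.
      by rewrite (zE i t)// (zE i s)// opprD addrACA subrr add0r incr.
    rewrite mulrBr -normrEsg lerD2l lerN2.
    rewrite (le_trans (ler_norm _))// normrM normr_sg ler_piMl//.
    by case: (_ != 0).
  have ib : leb.-integrable `[s, t] (EFin \o (fun x => (- W t) * g x +
     ((M t - M s) * m x + eta x))).
    apply: integrable_EFinD => //.
      by apply: integrable_EFinZl => //; exact: sub.
    apply: integrable_EFinD => //; last exact: sub.
    by apply: integrable_EFinZl => //; exact: sub.
  have H2 : \int[leb]_(x in `[s, t]) (\sum_(i < N) w i * Num.sg (z t i) * f x i)
      <= \int[leb]_(x in `[s, t]) ((- W t) * g x +
     ((M t - M s) * m x + eta x)).
    apply: ae_le_Rintegral => //.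
    apply: ae_imply coop => x {}coop; rewrite /= in_itv/= => /andP[sx xt].
    have [|a [a1 a2 a3 a4]] := coop.
      by rewrite /= in_itv/= (le_trans s0 sx) (le_trans xt tT).
    rewrite (_ : - W t * g x + ((M t - M s) * m x + eta x) =
      - g x * W t + (M t - M s) * m x + eta x); last by ring.
    apply: (@cooperative_step N w (z x) (z t) (f x) a (g x) (M t - M s)
      (eta x) (m x)) => //; last by rewrite subr_ge0 Mnd.
    move=> j jN; rewrite distrC.
    have x0 := le_trans s0 sx; have xT := le_trans xt tT.
    rewrite (le_trans (zincr _ _ _ _ x0 xt tT))// lerD2l lerN2 Mnd//.
  have gi' : leb.-integrable `[s, t] (EFin \o g) by exact: sub.
  have mi' : leb.-integrable `[s, t] (EFin \o m) by exact: sub.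
  have ei' : leb.-integrable `[s, t] (EFin \o eta) by exact: sub.
  have H3 : \int[leb]_(x in `[s, t]) ((- W t) * g x +
     ((M t - M s) * m x + eta x)) = - W t * (G t - G s) + ((M t - M s) ^+ 2 +
      \int[leb]_(x in `[s, t]) eta x).
    rewrite RintegralD//; last 2 first.
    - exact: integrable_EFinZl.
    - by apply: integrable_EFinD => //; exact: integrable_EFinZl.
    rewrite RintegralD//; last exact: integrable_EFinZl.
    by rewrite !RintegralZl// -(incr g)// -(incr m)// expr2.
  have := le_trans H1 H2; rewrite H3; lra.
(* The compensated quantity, whose increments turn out to be quadratic in those of [M]. *)
pose F t := expR (G t) * W t - E t.
suff : F T <= F 0.
  rewrite /F /E set_itv1 Rintegral_set1 subr0 G00 expR0 mul1r lerBlDr.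
  by rewrite addrC.
pose Bg := expR (M T).
apply: (@telescope_quadratic_le _ F M (Bg * (2 * Bw + 2))) => //.
- by rewrite mulr_ge0 ?expR_ge0// addr_ge0// mulr_ge0.
- move=> e e0; have [d d0 dP] := Rintegral_itv_small mi e0.
  exists d => // s t s0 st tT tsd.
  rewrite incr//; apply: le_lt_trans (dP s t s0 st tT tsd).
  rewrite le_eqVlt; apply/orP; left; apply/eqP; apply: eq_Rintegral => x _.
  by rewrite ger0_norm.
move=> s t s0 st tT D2.
have sT : s <= T by exact: le_trans tT.
have t0 : 0 <= t by exact: le_trans st.
have := key s t s0 st tT.
set D := M t - M s in D2 *; set I := \int[leb]_(x in `[s, t]) eta x.
have D0 : 0 <= D by rewrite subr_ge0 Mnd.
have dG : `|G t - G s| <= D by rewrite incr// absle.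
have I0 : 0 <= I by rewrite Rintegral_ge0.
have ID : I <= D by rewrite /I /D incr//; apply: le_Rintegral => //; exact: sub.
(* On the step [G] departs from [G s] by at most [D], so [expR (G x)] is at least
   [expR (G s) * (1 - D)]. *)
have EI : expR (G s) * (1 - D) * I <= E t - E s.
  rewrite /E incr// -RintegralZl//; last exact: sub.
  apply: le_Rintegral => //.
  - by apply: integrable_EFinZl => //; exact: sub.
  - exact: sub.
  move=> x /=; rewrite in_itv/= => /andP[sx xt].
  rewrite ler_wpM2r// -[G x](subrKC (G s)) expRD ler_wpM2l ?expR_ge0//.
  rewrite (le_trans _ (expR_ge1Dx _))// lerD2l.
  have xT := le_trans xt tT.
  have := absle g s x s0 sx xT gi gm.
  rewrite -incr// => /ler_normlP[+ _]; rewrite lerNl; apply: le_trans.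
  by rewrite lerN2 /D lerD2r Mnd// (le_trans s0).
have eGs : expR (G s) <= Bg by rewrite ler_expR (le_trans (ler_norm _))// GM.
have eGt : expR (G t) <= expR (G s) * (1 + (G t - G s) + 2 * D ^+ 2).
  rewrite -{1}[G t](subrKC (G s)) expRD ler_wpM2l ?expR_ge0//.
  apply: (le_trans (expR_le_quadratic _)).
    by rewrite (le_trans (ler_norm _))// (le_trans dG).
  rewrite lerD2l ler_wpM2l// -[leLHS]real_normK ?num_real//.
  by rewrite lerXn2r ?nnegrE.
move=> K.
have es0 := expR_ge0 (G s).
have H1 : expR (G t) * W t <= expR (G s) * (W s + D ^+ 2 + I + 2 * D ^+ 2 * Bw).
  apply: (le_trans (ler_wpM2r (W0 t) eGt)).
  rewrite -[leLHS]mulrA ler_wpM2l// mulrDl lerD//; first by rewrite mulrC.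
  apply: ler_wpM2l; first by rewrite mulr_ge0// sqr_ge0.
  exact: WB.
(* The first-order terms cancel; the remainder is of order [D ^+ 2] since [I <= D]. *)
have H2 : F t - F s <= expR (G s) * (D ^+ 2 + 2 * D ^+ 2 * Bw + D * I).
  rewrite (_ : expR (G s) * (D ^+ 2 + 2 * D ^+ 2 * Bw + D * I) =
    expR (G s) * (W s + D ^+ 2 + I + 2 * D ^+ 2 * Bw) - expR (G s) * W s -
    expR (G s) * (1 - D) * I); last by ring.
  by rewrite /F; lra.
apply: (le_trans H2).
have H3 : D * I <= D ^+ 2 by rewrite expr2 ler_wpM2l.
have H4 : D ^+ 2 + 2 * D ^+ 2 * Bw + D * I <= (2 * Bw + 2) * D ^+ 2.
  by move: H3; lra.
apply: (le_trans (ler_wpM2l es0 H4)); rewrite -mulrA ler_wpM2r//.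
by rewrite mulr_ge0 ?sqr_ge0// addr_ge0// mulr_ge0.
Qed.

End cooperative.

(** * Column sums of A* at a fixed time *)

Lemma cvg_sumr {R : realType} (T : Type) (F : set_system T) (I : Type) (r : seq I)
    (u : I -> T -> R) (l : I -> R) : Filter F ->
  (forall i, u i x @[x --> F] --> l i) ->
  \sum_(i <- r) u i x @[x --> F] --> \sum_(i <- r) l i.
Proof.
move=> FF ul; elim: r => [|i r ih].
  by under eq_cvg do rewrite big_nil; rewrite big_nil; exact: cvg_cst.
by under eq_cvg do rewrite big_cons; rewrite big_cons; exact: cvgD.
Qed.

Section pointwise.
Context {R : realType}.
Variables (lam mu : nat -> nat -> R -> R) (beta : nat -> R -> R)
  (q : nat -> nat -> R -> R).
Hypothesis q_def : queue_intensities lam mu beta q.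
Variable t : R.
Hypothesis t0 : 0 <= t.

Notation bs := (beta_star beta t).
Notation a := (a_star mu beta q t).

Lemma intensity_ge0 i j : i != j -> 0 <= q i j t.
Proof.
have [[l0 [m0 b0]] ql qm q0 _] := q_def t0.
rewrite neq_ltn => /orP[ij|ji]; first by rewrite ql// l0.
have [j0|j0] := posnP j; last by rewrite qm ?j0// m0.
by rewrite j0 in ji *; rewrite q0// addr_ge0 ?m0 ?b0.
Qed.

Lemma row_sum_le n n' j : (j < n)%N -> (n <= n')%N ->
  \sum_(i < n) q j i t <= \sum_(i < n') q j i t.
Proof.
move=> jn nn'; rewrite -!(big_mkord xpredT (fun i => q j i t)).
rewrite [leRHS](@big_cat_nat _ _ _ n)//= lerDl big_nat_cond; apply: sumr_ge0 => i.
rewrite andbT => /andP[ni _]; apply: intensity_ge0.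
by rewrite ltn_eqF// (leq_trans jn).
Qed.

Lemma row_sum_cvg j : (fun n => \sum_(i < n) q j i t) @ \oo --> (0 : R).
Proof.
have [_ _ _ _ /(_ j)] := q_def t0.
by under eq_cvg do rewrite seriesEord.
Qed.

(** Once the diagonal entry is included, the partial sums of a row of Q can only increase, and their
    limit is 0. *)
Lemma row_sum_le0 n j : (j < n)%N -> \sum_(i < n) q j i t <= 0.
Proof.
move=> jn; apply: (cvgr_to_ge (row_sum_cvg j)).
by exists n => // m /= nm; exact: row_sum_le.
Qed.

Lemma intensity_diag_le0 j : q j j t <= 0.
Proof.
apply: le_trans (row_sum_le0 (ltnSn j)).
rewrite big_ord_recr/= lerDr sumr_ge0// => i _.
by rewrite intensity_ge0// gtn_eqF.
Qed.

Lemma beta_star_ge0 : 0 <= bs.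
Proof.
have [[_ [_ b0]] _ _ _ _] := q_def t0.
apply: lb_le_inf; first by exists (beta 1%N t), 1%N.
by move=> _ [i /= i1 <-]; exact: b0.
Qed.

Lemma beta_star_le i : (1 <= i)%N -> bs <= q i 0%N t.
Proof.
have [[_ [m0 b0]] _ _ q0 _] := q_def t0.
move=> i1; rewrite q0//; apply: (@le_trans _ _ (beta i t)).
  apply: ge_inf; last by exists i.
  by exists 0 => _ [k /= k1 <-]; exact: b0.
by rewrite lerDr m0.
Qed.

(** The case distinction collapses to a rank-one correction: [beta_star] is subtracted along the
    whole of row 0. Hence A z = A* z + beta_* (sum z) e_0. *)
Lemma a_starE i j : a i j = q j i t - (i == 0%N)%:R * bs.
Proof.
rewrite /a_star; case: eqVneq => [->|_]; last by rewrite mul0r subr0.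
rewrite mul1r; case: posnP => [->//|j0].
by have [_ _ _ q0 _] := q_def t0; rewrite q0.
Qed.

Lemma a_star_ge0 i j : i != j -> 0 <= a i j.
Proof.
move=> ij; rewrite a_starE; case: eqVneq => [i0|_].
  rewrite mul1r subr_ge0 i0 beta_star_le// lt0n -i0 eq_sym//.
by rewrite mul0r subr0 intensity_ge0// eq_sym.
Qed.

Lemma a_star_diag_le0 j : a j j <= 0.
Proof.
rewrite a_starE subr_le0 (le_trans (intensity_diag_le0 j))//.
by rewrite mulr_ge0// beta_star_ge0.
Qed.

Lemma a_star_sum n j : (0 < n)%N ->
  \sum_(i < n) a i j = \sum_(i < n) q j i t - bs.
Proof.
case: n => // n _.
under eq_bigr do rewrite a_starE; rewrite sumrB; congr (_ - _).
rewrite -mulr_suml big_ord_recl/= big1 ?addr0 ?mul1r// => i _.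
Qed.

Section weights.
Variables (dk : nat -> R) (dk_pos : forall k, 0 < dk k).
Variable b : R.
Hypothesis bP : (b%:E <= beta_sstar dk mu beta q t)%E.

(** The infinite off-diagonal sum in the [j]-th term of the infimum dominates the finite one;
    multiplying by [dk j] removes the normalization of [a_starD]. *)
Lemma weighted_column_le n j : (j < n)%N ->
  \sum_(i < n) dk i * a i j <= - b * dk j.
Proof.
move=> jn.
have /(le_trans bP) : (beta_sstar dk mu beta q t <=
    (`|a_starD dk mu beta q t j j|)%:E -
    \sum_(0 <= k <oo | k != j) (a_starD dk mu beta q t k j)%:E)%E.
  by apply: ereal_inf_lbound; exists j.
have aD0 k : k != j -> 0 <= a_starD dk mu beta q t k j.
  by move=> kj; rewrite /a_starD !mulr_ge0 ?invr_ge0 ?a_star_ge0 ?ltW.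
have H : ((\sum_(k < n | (k : nat) != j) a_starD dk mu beta q t k j)%:E <=
    \sum_(0 <= k <oo | k != j) (a_starD dk mu beta q t k j)%:E)%E.
  rewrite -sumEFin -(big_mkord (fun k => k != j)
    (fun k => (a_starD dk mu beta q t k j)%:E)).
  by apply: nneseries_lim_ge => k _ kj; rewrite lee_fin aD0.
move=> /le_trans /(_ (leeB (lexx _) H)).
rewrite -EFinB lee_fin /a_starD => {}H.
rewrite (bigD1 (Ordinal jn))//=.
have E : \sum_(i < n | i != Ordinal jn) dk i * a i j =
    (\sum_(i < n | (i : nat) != j) dk i * a i j / dk j) * dk j.
  rewrite mulr_suml; apply: eq_bigr => i _.
  by rewrite divfK// gt_eqF.
have dj := dk_pos j.
rewrite E; set s := \sum_(_ < _ | _) _ in H *.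
rewrite mulrAC divff ?gt_eqF// mul1r ler0_norm ?a_star_diag_le0// in H.
rewrite -subr_ge0.
have -> : - b * dk j - (dk j * a j j + s * dk j) = (- a j j - s - b) * dk j by ring.
by rewrite mulr_ge0 ?(ltW dj)// subr_ge0.
Qed.

Variable K : R.
Hypothesis KP : forall j n, \sum_(i < n) `|q j i t| <= K.
Hypothesis dk_inf : 0 < inf (range dk).

Let d := inf (range dk).

Lemma dk_ge_inf k : d <= dk k.
Proof.
apply: ge_inf; last by exists k.
by exists 0 => _ [i _ <-]; exact: ltW.
Qed.

(* Column j of the weighted inequality, for dk j close to d = inf dk: the
   weights dk i >= d only increase the off-diagonal part, and the plain column
   sum is - beta_star. *)
Lemma beta_sstar_le_beta_star : b <= bs.
Proof.
have K0 : 0 <= K by rewrite (le_trans _ (KP 0 0))// big_ord0.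
(* Letting [n] grow turns the plain column sum into [- bs]; the excess weight [dk j - d] of the
   diagonal entry costs at most [(dk j - d) * (K + bs)]. *)
have step j : b * dk j <= dk j * bs + (dk j - d) * K.
  have dj := dk_pos j.
  have H n : (j < n)%N ->
      (dk j - d) * a j j + d * (\sum_(i < n) q j i t - bs) <= - b * dk j.
    move=> jn; apply: le_trans (weighted_column_le jn).
    rewrite -a_star_sum ?(leq_trans _ jn)//.
    rewrite (bigD1 (Ordinal jn))//= [leRHS](bigD1 (Ordinal jn))//=.
    rewrite mulrDr addrA -mulrDl subrK lerD2l mulr_sumr ler_sum// => i ij.
    by rewrite ler_wpM2r ?dk_ge_inf// a_star_ge0.
  have H' : (dk j - d) * a j j + d * (0 - bs) <= - b * dk j.
    have L : (fun n => (dk j - d) * a j j + d * (\sum_(i < n) q j i t - bs))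
        @ \oo --> (dk j - d) * a j j + d * (0 - bs).
      apply: cvgD; first exact: cvg_cst.
      apply: cvgM; first exact: cvg_cst.
      by apply: cvgB; [exact: row_sum_cvg|exact: cvg_cst].
    by apply: (cvgr_to_le L); exists j.+1 => // n /=; exact: H.
  have ajj : - a j j <= K + bs.
    rewrite a_starE opprB addrC lerD//.
      rewrite (le_trans _ (KP j j.+1))// big_ord_recr/=.
      by rewrite ler0_norm ?intensity_diag_le0// lerDr sumr_ge0.
    by rewrite ler_piMl ?beta_star_ge0//; case: (_ == _).
  have dd : 0 <= dk j - d by rewrite subr_ge0 dk_ge_inf.
  have := ler_wpM2l dd ajj.
  by move: H'; lra.
apply/ler_addgt0Pr => e e0.
(* This closeness of [dk j] to [d] makes the error [(dk j - d) * K] at most [e * d], hence at most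
   [e * dk j]. *)
have [_ [j _ <-] dje] : exists2 x, range dk x & x < d + e * d / (K + 1).
  apply: inf_adherent; first by rewrite divr_gt0 ?mulr_gt0// ltr_wpDl.
  split; first by exists (dk 0%N), 0%N.
  by exists 0 => _ [i _ <-]; exact: ltW.
have dj := dk_pos j.
rewrite -(ler_pM2r dj) (le_trans (step j))// [leRHS]mulrDl [X in _ <= X + _]mulrC lerD2l.
apply: (@le_trans _ _ (e * d)); last by rewrite ler_wpM2l ?dk_ge_inf// (ltW e0).
have K1 : 0 < K + 1 by rewrite ltr_wpDl.
have : (dk j - d) * (K + 1) <= e * d.
  by rewrite -ler_pdivlMr// lerBlDl (ltW dje).
have : 0 <= dk j - d by rewrite subr_ge0 dk_ge_inf.
lra.
Qed.

Lemma truncated_column_le M n j : 0 < M -> (j < n)%N ->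
  \sum_(i < n) Num.min (dk i) M * a i j <= - b * Num.min (dk j) M.
Proof.
move=> M0 jn.
(* Raising the other weights while keeping that of [j] only increases the sum, the off-diagonal
   entries being nonnegative. *)
have le (w' : nat -> R) : Num.min (dk j) M = w' j ->
    (forall i, Num.min (dk i) M <= w' i) ->
    \sum_(i < n) Num.min (dk i) M * a i j <= \sum_(i < n) w' i * a i j.
  move=> wj ww; rewrite (bigD1 (Ordinal jn))//= [leRHS](bigD1 (Ordinal jn))//=.
  rewrite wj lerD2l ler_sum// => i ij.
  by rewrite ler_wpM2r// a_star_ge0.
have [djM|Mdj] := leP (dk j) M.
  apply: le_trans (weighted_column_le jn); apply: le => [|i].
    exact/min_idPl.
  by rewrite ge_min lexx.
apply: (@le_trans _ _ (\sum_(i < n) M * a i j)).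
  apply: (le (fun=> M)) => [|i]; first exact/min_idPr/ltW.
  by rewrite ge_min lexx orbT.
rewrite -mulr_sumr mulrC ler_wpM2r ?(ltW M0)// a_star_sum ?(leq_trans _ jn)//.
by rewrite -[leRHS]add0r lerD ?row_sum_le0// lerN2 beta_sstar_le_beta_star.
Qed.

End weights.

Section truncation_error.
Variable K : R.
Hypothesis KP : forall j n, \sum_(i < n) `|q j i t| <= K.

Lemma beta_star_le_bound : bs <= K.
Proof.
rewrite (le_trans (beta_star_le (leqnn 1)))// (le_trans _ (KP 1 1))//.
by rewrite big_ord1 ler_norm.
Qed.

(** One [K] comes from the column of A, the other from the correction in row 0, since beta_* <= q_10
    <= K. *)
Lemma a_star_column_norm n j : \sum_(i < n) `|a i j| <= 2 * K.
Proof.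
have K0 : 0 <= K by rewrite (le_trans beta_star_ge0) ?beta_star_le_bound.
case: n => [|n]; first by rewrite big_ord0 mulr_ge0.
apply: (@le_trans _ _ (\sum_(i < n.+1) (`|q j i t| + ((i : nat) == 0%N)%:R * bs))).
  apply: ler_sum => i _; rewrite a_starE (le_trans (ler_normB _ _))//.
  by rewrite lerD2l ger0_norm// mulr_ge0 ?beta_star_ge0.
rewrite big_split/= mulr_natl mulr2n lerD ?KP// -mulr_suml big_ord_recl/= big1 ?addr0 ?mul1r//.
exact: beta_star_le_bound.
Qed.

(** Here [f] is A z for the full matrix, [S] the sum of [z] and [nu] its l_1-norm. Replacing A by
    the truncated A* leaves the rank-one term in row 0, bounded by [w 0 * c], and the columns beyond
    [n], each of weighted norm at most [2 * M * K]. *)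
Lemma truncation_error_le (n : nat) (w z f : nat -> R) (M nu S c : R) :
  (0 < n)%N -> (forall i, 0 <= w i <= M) ->
  (fun m => \sum_(j < m) `|z j|) @ \oo --> nu ->
  (fun m => \sum_(j < m) z j) @ \oo --> S ->
  (forall i, (fun m => \sum_(j < m) q j i t * z j) @ \oo --> f i) ->
  bs * `|S| <= c ->
  \sum_(i < n) w i * `|f i - \sum_(j < n) a i j * z j| <=
    w 0%N * c + 2 * M * K * (nu - \sum_(j < n) `|z j|).
Proof.
move=> n0 wM znu zS zf Sc.
have w0 i : 0 <= w i by case/andP: (wM i).
have M0 : 0 <= M by case/andP: (wM 0%N); exact: le_trans.
(* All the infinite sums are cut at a common index [m], where the decomposition is a finite
   identity; then [m] tends to infinity. *)
pose e m (i : 'I_n) := \sum_(j < m) q j i t * z j - \sum_(j < n) a i j * z j.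
have H m : (n <= m)%N -> \sum_(i < n) w i * `|e m i| <=
    w 0%N * (bs * `|\sum_(j < m) z j|) +
    2 * M * K * (\sum_(j < m) `|z j| - \sum_(j < n) `|z j|).
  move=> nm.
  have tailE (F : nat -> R) : \sum_(j < m) F j - \sum_(j < n) F j =
      \sum_(n <= j < m) F j.
    rewrite -!(big_mkord xpredT F) [X in X - _](@big_cat_nat _ _ _ n)//=.
    by rewrite [_ + \sum_(n <= _ < _) _]addrC addrK.
  have eE i : e m i = \sum_(n <= j < m) a i j * z j +
      ((i : nat) == 0%N)%:R * bs * \sum_(j < m) z j.
    rewrite -tailE /e mulr_sumr addrAC -big_split/=; congr (_ - _).
    by apply: eq_bigr => j _; rewrite a_starE; ring.
  apply: (@le_trans _ _ (\sum_(i < n) (w i * (((i : nat) == 0%N)%:R *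
      (bs * `|\sum_(j < m) z j|)) + \sum_(n <= j < m) M * `|a i j| * `|z j|))).
    apply: ler_sum => i _; rewrite eE addrC.
    apply: (le_trans (ler_wpM2l (w0 i) (ler_normD _ _))).
    rewrite mulrDr lerD//.
      rewrite ler_wpM2l// !normrM mulrA ger0_norm// (ger0_norm beta_star_ge0)//.
    rewrite (le_trans (ler_wpM2l (w0 i) (ler_norm_sum _ _ _)))//.
    rewrite mulr_sumr; apply: ler_sum => j _; rewrite normrM mulrA.
    by rewrite !ler_wpM2r//; case/andP: (wM i).
  rewrite big_split/= lerD//.
    case: n n0 {e eE tailE nm} => // n' _.
    by rewrite big_ord_recl/= mul1r [X in _ + X]big1 ?addr0// => i _; rewrite mul0r mulr0.
  rewrite exchange_big/= (tailE (fun j => `|z j|)) mulr_sumr; apply: ler_sum => j _.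
  rewrite -mulr_suml ler_wpM2r// -mulr_sumr -mulrA mulrCA ler_wpM2l//.
  exact: a_star_column_norm.
apply: (@le_trans _ _ (w 0%N * (bs * `|S|) +
    2 * M * K * (nu - \sum_(j < n) `|z j|))); last first.
  by rewrite lerD2r ler_wpM2l.
have L : (fun m => \sum_(i < n) w i * `|e m i|) @ \oo -->
    \sum_(i < n) w i * `|f i - \sum_(j < n) a i j * z j|.
  apply: cvg_sumr => i; apply: cvgM; first exact: cvg_cst.
  apply: cvg_norm; apply: cvgB; last exact: cvg_cst.
  exact: zf.
have Rr : (fun m => w 0%N * (bs * `|\sum_(j < m) z j|) +
    2 * M * K * (\sum_(j < m) `|z j| - \sum_(j < n) `|z j|)) @ \oo -->
    w 0%N * (bs * `|S|) + 2 * M * K * (nu - \sum_(j < n) `|z j|).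
  apply: cvgD.
    apply: cvgM; first exact: cvg_cst.
    apply: cvgM; first exact: cvg_cst.
    exact: cvg_norm.
  apply: cvgM; first exact: cvg_cst.
  by apply: cvgB => //; exact: cvg_cst.
apply: (ler_cvg_to L Rr).
by exists n => // m /=; exact: H.
Qed.

End truncation_error.
End pointwise.

(** * Measurability and integrability of the rates *)

Section standing.
Context {R : realType}.
Notation leb := (@lebesgue_measure R).
Variables (lam mu : nat -> nat -> R -> R) (beta : nat -> R -> R)
  (q : nat -> nat -> R -> R).
Hypothesis q_def : queue_intensities lam mu beta q.
Hypothesis q_reg : standing_assumptions beta q.

(** The K of the estimates. Where the operator norm is infinite [fine] returns 0, which for [t >= 0]
    happens only on a null set. *)
Definition opbound (t : R) : R := fine (l1_opnorm (forward_op q t)).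

Lemma l1_norm_ge0 (z : nat -> R) : (0 <= l1_norm z)%E.
Proof. by apply: nneseries_ge0 => k _ _; rewrite lee_fin. Qed.

Lemma l1_opnorm_ge0 (a : nat -> nat -> R) : (0 <= l1_opnorm a)%E.
Proof.
apply: (le_trans (l1_norm_ge0 (l1_apply a (fun=> 0)))).
apply: ereal_sup_ubound; exists (fun=> 0) => //=.
rewrite (_ : l1_norm _ = 0%E)//; apply: eseries0 => i _ _.
by rewrite normr0.
Qed.

Lemma opbound_ge0 t : 0 <= opbound t.
Proof. by rewrite fine_ge0// l1_opnorm_ge0. Qed.

Lemma partial_sum_le_l1_norm (z : nat -> R) n :
  ((\sum_(i < n) `|z i|)%:E <= l1_norm z)%E.
Proof.
rewrite -sumEFin -(big_mkord xpredT (fun i => (`|z i|)%:E)).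
by apply: nneseries_lim_ge => k _ _; rewrite lee_fin.
Qed.

(** The operator norm is tested on the [j]-th basis vector, whose image is column [j]. *)
Lemma column_norm_le_opnorm (a : nat -> nat -> R) j n :
  ((\sum_(i < n) `|a i j|)%:E <= l1_opnorm a)%E.
Proof.
pose e k : R := (k == j)%:R.
have -> : \sum_(i < n) `|a i j| = \sum_(i < n) `|l1_apply a e i|.
  apply: eq_bigr => i _; congr `|_|; apply/esym/cvg_lim => //.
  apply: cvg_near_cst; exists j.+1 => // k /= jk; rewrite seriesEord/= (bigD1 (Ordinal jk))//=.
  rewrite /e eqxx mulr1 big1 ?addr0// => l lj.
  by rewrite (negbTE (_ : (l : nat) != j)) ?mulr0.
apply: le_trans (partial_sum_le_l1_norm _ _) _.
apply: ereal_sup_ubound; exists e => //=.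
apply: lime_le.
  by apply: is_cvg_nneseries => k _ _; rewrite lee_fin.
apply: nearW => m; rewrite big_mkord sumEFin lee_fin /e.
have [jm|mj] := ltnP j m; last first.
  by rewrite big1// => i _; rewrite ltn_eqF ?normr0// (leq_trans (ltn_ord i)).
rewrite (bigD1 (Ordinal jm))//= eqxx normr1 big1 ?addr0// => i ij.
by rewrite (negbTE (_ : (i : nat) != j)) ?normr0.
Qed.

Lemma column_norm_ae : {ae leb, forall t, 0 <= t ->
  forall j n, \sum_(i < n) `|q j i t| <= opbound t}.
Proof.
have [_ _ fin _] := q_reg; apply: ae_imply fin => t + t0 => /(_ t0) fin j n.
rewrite -lee_fin fineK; first exact: column_norm_le_opnorm.
by rewrite ge0_fin_numE ?l1_opnorm_ge0.
Qed.

Lemma opbound_integrable u : 0 <= u ->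
  leb.-integrable `[0, u] (EFin \o opbound).
Proof.
move=> u0; have [_ _ _ /(_ _ u0) Ki] := q_reg.
apply: le_integrable (Ki) => //.
  apply/measurable_EFinP; apply: measurableT_comp => //.
  exact: (measurable_int leb Ki).
move=> x _ /=; rewrite /opbound.
by case: (l1_opnorm _) => [r| |]//=; rewrite ?normr0 leey.
Qed.

Lemma q_measurable (u : R) i j : 0 <= u -> measurable_fun `[0, u] (q i j).
Proof.
move=> u0; have [[qi _] _ _ _] := q_reg.
by apply/measurable_EFinP; exact: (measurable_int leb (qi i j u u0)).
Qed.

Lemma beta_star_measurable (u : R) : 0 <= u -> measurable_fun `[0, u] (beta_star beta).
Proof.
move=> u0; have [[_ bi] _ _ _] := q_reg.
have -> : beta_star beta = (fun t => infs (fun k => beta k.+1 t) 0).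
  apply/funext => t; rewrite /beta_star /infs; congr inf.
  apply/seteqP; split => x /=.
    by move=> [[//|k] _ <-]; exists k.
  by move=> [k _ <-]; exists k.+1.
apply: measurable_fun_infs.
  move=> t; rewrite /= in_itv/= => /andP[t0 _]; exists 0 => _ [k _ <-].
  by have [[_ [_ b0]] _ _ _ _] := q_def t0; exact: b0.
move=> k; apply/measurable_EFinP.
exact: (measurable_int leb (bi k.+1 isT u u0)).
Qed.

Lemma a_star_measurable (u : R) i j : 0 <= u ->
  measurable_fun `[0, u] (fun t => a_star mu beta q t i j).
Proof.
move=> u0; apply: (eq_measurable_fun
  (fun t => q j i t - (i == 0%N)%:R * beta_star beta t)).
  by move=> t; rewrite inE/= in_itv/= => /andP[t0 _]; rewrite (a_starE q_def t0).
apply: measurable_funB; first exact: q_measurable.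
by apply: measurable_funM => //; exact: beta_star_measurable.
Qed.

Variables (dk : nat -> R).
Hypothesis dk_pos : forall k, 0 < dk k.
Hypothesis dk_inf : 0 < inf (range dk).

Notation bss := (beta_sstar dk mu beta q).

Lemma beta_sstar_measurable (u : R) : 0 <= u -> measurable_fun `[0, u] bss.
Proof.
move=> u0.
have aDm i j : measurable_fun `[0, u] (fun t => a_starD dk mu beta q t i j).
  by apply: measurable_funM => //; apply: measurable_funM => //;
    exact: a_star_measurable.
pose h i t := ((`|a_starD dk mu beta q t i i|)%:E -
      \sum_(0 <= j <oo | j != i) (a_starD dk mu beta q t j i)%:E)%E.
have -> : bss = (fun t => einfs (h ^~ t) 0).
  apply/funext => t; rewrite /beta_sstar /einfs; congr ereal_inf.
  by apply/seteqP; split => x /= [k _ <-]; exists k.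
apply: measurable_fun_einfs => i; apply: emeasurable_funB.
  by apply/measurable_EFinP; apply: measurableT_comp.
apply: ge0_emeasurable_sum => [j t|j _]; last exact/measurable_EFinP.
rewrite /= in_itv/= => /andP[t0 _] ji; rewrite lee_fin /a_starD.
by rewrite divr_ge0 ?mulr_ge0 ?(a_star_ge0 q_def t0)// ltW.
Qed.

Lemma beta_sstar_le t : 0 <= t ->
  (forall j n, \sum_(i < n) `|q j i t| <= opbound t) ->
  (bss t <= (beta_star beta t)%:E)%E.
Proof.
move=> t0 KP; have bl b := beta_sstar_le_beta_star (b := b) q_def t0 dk_pos.
case E : (bss t) => [r| |]; last by rewrite leNye.
  by rewrite lee_fin; apply: (bl r _ (opbound t)) => //; rewrite E.
(* If beta_** were infinite, [beta_star beta t + 1] would be a real lower bound of it, hence at most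
   [beta_star beta t]. *)
have := bl (beta_star beta t + 1) _ _ KP dk_inf; rewrite E leey => /(_ isT).
by rewrite -subr_ge0 opprD addrA subrr add0r oppr_ge0 ler10.
Qed.

Variables (Rss b : R).
Hypothesis decay : forall s t : R, 0 <= s <= t ->
  (expeR (- \int[leb]_(tau in `[s, t]) bss tau)
     <= (Rss * expR (- (b * (t - s))))%:E)%E.

(** The positive part lies below beta_* and so below [opbound]. If the negative part had infinite
    integral, the left side of [decay] on [[0, u]] would be infinite. *)
Lemma beta_sstar_integrable (u : R) : 0 <= u -> leb.-integrable `[0, u] bss.
Proof.
move=> u0; have mb := beta_sstar_measurable u0.
apply/integrableP; split => //.
have Kfin := @integrable_lty _ _ R leb _ (measurable_itv `[0, u]) _
  (opbound_integrable u0).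
have posfin : (\int[leb]_(x in `[0%R, u]) (bss^\+ x) < +oo)%E.
  apply: le_lt_trans Kfin; apply: ae_ge0_le_integral => //.
  - exact: measurable_funepos.
  - by move=> x _; rewrite lee_fin opbound_ge0.
  - exact: (measurable_int leb (opbound_integrable u0)).
  - apply: ae_imply column_norm_ae => x KP; rewrite /= in_itv/= => /andP[x0 _].
    rewrite funeposE ge_max lee_fin opbound_ge0 andbT.
    apply: (le_trans (beta_sstar_le x0 (KP x0))).
    by rewrite lee_fin (beta_star_le_bound q_def x0)//; exact: KP.
have negfin : (\int[leb]_(x in `[0%R, u]) (bss^\- x) < +oo)%E.
  have : (0 : R) <= 0 <= u by apply/andP; split.
  move=> /decay; rewrite integralE; rewrite ltey; apply: contraTN => /eqP ->.
  have : (\int[leb]_(x in `[0%R, u]) (bss^\+ x) \is a fin_num)%E.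
    by rewrite ge0_fin_numE// integral_ge0.
  by move=> /fineK <-.
have -> : (fun x => `|bss x|)%E = (bss^\+ \+ bss^\-)%E.
  by rewrite -fune_abse.
rewrite ge0_integralD//.
- by rewrite lte_add_pinfty.
- exact: measurable_funepos.
- exact: measurable_funeneg.
Qed.

Lemma beta_sstar_fin_num (u : R) : 0 <= u ->
  {ae leb, forall t, `[0, u]%classic t -> bss t = (fine (bss t))%:E}.
Proof.
move=> u0; have := @integrable_ae _ _ R leb _ (measurable_itv `[0, u]) _
  (beta_sstar_integrable u0).
by apply: ae_imply => t H tu; rewrite fineK// H.
Qed.

Lemma fine_beta_sstar_integrable (u : R) : 0 <= u ->
  leb.-integrable `[0, u] (EFin \o (fine \o bss)).
Proof.
move=> u0; apply: le_integrable (beta_sstar_integrable u0) => //.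
  apply/measurable_EFinP; apply: measurableT_comp => //.
  exact: beta_sstar_measurable.
move=> x _ /=.
by case: (bss _) => [r| |]//=; rewrite ?normr0 leey.
Qed.

Lemma fine_decay s t : 0 <= s -> s <= t ->
  expR (- \int[leb]_(x in `[s, t]) fine (bss x)) <=
  Rss * expR (- (b * (t - s))).
Proof.
move=> s0 st; have t0 := le_trans s0 st.
have bi : leb.-integrable `[s, t] bss.
  apply: integrableS (beta_sstar_integrable t0) => //.
  by apply: subset_itv; rewrite bnd_simp.
have gi := fine_beta_sstar_integrable t0.
have := decay (s := s) (t := t); rewrite s0 st => /(_ isT).
rewrite (_ : (\int[leb]_(tau in `[s, t]) bss tau)%E =
  (\int[leb]_(x in `[s, t]) fine (bss x))%:E); first by rewrite lee_fin.
rewrite /Rintegral fineK; last first.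
  by apply: integrable_fin_num => //; apply: (integrable_subitv s0 _ gi).
apply: ae_eq_integral => //.
- exact: (measurable_int leb bi).
- exact: (measurable_int leb (integrable_subitv s0 (lexx t) gi)).
- apply: ae_imply (beta_sstar_fin_num t0) => x H; rewrite /= in_itv/= => /andP[sx xt].
  by apply: H; rewrite /= in_itv/= (le_trans s0 sx).
Qed.

End standing.

(** * Coordinatewise solutions of the forward system *)

Section mild.
Context {R : realType}.
Notation leb := (@lebesgue_measure R).

Lemma Rintegral_cvg0 (D : set R) (h : nat -> R -> R) (H : R -> R) :
  measurable D -> (forall n, measurable_fun D (h n)) ->
  leb.-integrable D (EFin \o H) ->
  {ae leb, forall x, D x -> (forall n, `|h n x| <= H x) /\
    h ^~ x @ \oo --> (0 : R)} ->
  (fun n => \int[leb]_(x in D) h n x) @ \oo --> (0 : R).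
Proof.
move=> mD mh iH hH.
have [] // := @dominated_convergence _ _ R leb D mD (fun n => EFin \o h n)
  (cst 0%E) (EFin \o H).
- by move=> n; apply/measurable_EFinP; exact: mh.
- apply: ae_imply hH => x hH Dx; apply/cvg_EFin; first exact: nearW.
  by have [] := hH Dx.
- apply: ae_imply hH => x hH n Dx; rewrite lee_fin.
  by have [+ _] := hH Dx; exact.
move=> _ _; rewrite integral0 => /fine_cvgP[_]; exact.
Qed.

(* f stands for A z, and nu for the l_1-norm of z. *)
Definition mild_solution (q : nat -> nat -> R -> R) (z f : R -> nat -> R)
    (nu : R -> R) : Prop :=
  [/\ forall u i, 0 <= u -> leb.-integrable `[0, u] (EFin \o f ^~ i),
      forall i t, 0 <= t -> z t i = z 0 i + \int[leb]_(x in `[0, t]) f x i,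
      {ae leb, forall t, 0 <= t -> forall i,
        (fun n => \sum_(j < n) q j i t * z t j) @ \oo --> f t i},
      forall t, 0 <= t -> (fun n => \sum_(j < n) `|z t j|) @ \oo --> nu t
    & forall u, 0 <= u -> exists B, forall t, 0 <= t -> t <= u -> nu t <= B].

Section theory.
Variables (q : nat -> nat -> R -> R) (z f : R -> nat -> R) (nu : R -> R).
Hypothesis sol : mild_solution q z f nu.

Lemma mild_measurable (u : R) i : 0 <= u -> measurable_fun `[0, u] (z ^~ i).
Proof.
have [fi zE _ _ _] := sol; move=> u0.
have E : {in `[0, u]%classic, (fun t => z 0 i + \int[leb]_(x in `[0, t]) f x i)
    =1 z ^~ i}.
  by move=> t; rewrite inE/= in_itv/= => /andP[t0 _]; rewrite -zE.
apply: (eq_measurable_fun _ E).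
apply: measurable_funD => //; apply: subspace_continuous_measurable_fun => //.
by apply: parameterized_integral_continuous => //; exact: fi.
Qed.

Lemma mild_norm_measurable (u : R) : 0 <= u -> measurable_fun `[0, u] nu.
Proof.
have [_ _ _ znu _] := sol; move=> u0.
apply: (@measurable_fun_cvg _ _ _ _ (fun n t => \sum_(j < n) `|z t j|)).
  move=> n; apply: measurable_sum => j.
  by apply: measurableT_comp => //; exact: mild_measurable.
by move=> t; rewrite /= in_itv/= => /andP[t0 _]; exact: znu.
Qed.

Lemma mild_partial_le t n : 0 <= t -> \sum_(j < n) `|z t j| <= nu t.
Proof.
move=> t0; have [_ _ _ /(_ _ t0) znu _] := sol.
apply: (cvgr_to_ge znu); exists n => // m /= nm.
rewrite -!(big_mkord xpredT (fun j => `|z t j|)).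
by rewrite [leRHS](@big_cat_nat _ _ _ n)//= lerDl sumr_ge0.
Qed.

(** The double sum is exchanged before the limit in the inner index. The bound supplies the majorant
    in the proof that mass is conserved. *)
Lemma mild_image_partial_le (K : R) t n : 0 <= t ->
  (forall j n, \sum_(i < n) `|q j i t| <= K) ->
  (forall i, (fun n => \sum_(j < n) q j i t * z t j) @ \oo --> f t i) ->
  `|\sum_(i < n) f t i| <= K * nu t.
Proof.
move=> t0 KP zf.
have L : (fun m => `|\sum_(i < n) \sum_(j < m) q j i t * z t j|) @ \oo -->
    `|\sum_(i < n) f t i|.
  by apply: cvg_norm; exact: cvg_sumr.
apply: (cvgr_to_le L); apply: nearW => m.
have K0 : 0 <= K by rewrite (le_trans _ (KP 0 0))// big_ord0.
apply: (le_trans _ (ler_wpM2l K0 (mild_partial_le m t0))).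
rewrite exchange_big/= (le_trans (ler_norm_sum _ _ _))// mulr_sumr.
apply: ler_sum => j _; rewrite -mulr_suml normrM ler_wpM2r//.
exact: le_trans (ler_norm_sum _ _ _) (KP j n).
Qed.

(* Tannery: the partial column sums are bounded by K and tend to 0. *)
Lemma mild_image_sum_cvg0 (K : R) t : 0 <= t ->
  (forall j n, \sum_(i < n) `|q j i t| <= K) ->
  (forall j, (fun n => \sum_(i < n) q j i t) @ \oo --> (0 : R)) ->
  (forall i, (fun n => \sum_(j < n) q j i t * z t j) @ \oo --> f t i) ->
  (fun n => \sum_(i < n) f t i) @ \oo --> (0 : R).
Proof.
move=> t0 KP q0 zf; have [_ _ _ /(_ _ t0) znu _] := sol.
have K0 : 0 <= K by rewrite (le_trans _ (KP 0 0))// big_ord0.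
have bound J n : `|\sum_(i < n) f t i| <=
    \sum_(j < J) `|\sum_(i < n) q j i t| * `|z t j| +
    K * (nu t - \sum_(j < J) `|z t j|).
  have L : (fun m => `|\sum_(i < n) \sum_(j < m) q j i t * z t j|) @ \oo -->
      `|\sum_(i < n) f t i|.
    by apply: cvg_norm; exact: cvg_sumr.
  apply: (cvgr_to_le L); exists J => // m /= Jm.
  rewrite exchange_big/= (le_trans (ler_norm_sum _ _ _))//.
  rewrite [leLHS](eq_bigr (fun j : 'I_m => `|\sum_(i < n) q j i t| * `|z t j|));
    last by move=> j _; rewrite -mulr_suml normrM.
  rewrite -(big_mkord xpredT (fun j => `|\sum_(i < n) q j i t| * `|z t j|)).
  rewrite (@big_cat_nat _ _ _ J)//= big_mkord lerD2l.
  apply: (@le_trans _ _ (K * (\sum_(j < m) `|z t j| - \sum_(j < J) `|z t j|))).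
    rewrite -!(big_mkord xpredT (fun j => `|z t j|)).
    rewrite [X in _ * (X - _)](@big_cat_nat _ _ _ J)//=.
    rewrite [_ + \sum_(J <= _ < _) _]addrC addrK mulr_sumr; apply: ler_sum => j _.
    by rewrite ler_wpM2r// (le_trans (ler_norm_sum _ _ _)) ?KP.
  by rewrite ler_wpM2l// lerD2r mild_partial_le.
apply/cvgrPdist_le => e e0.
have epos : 0 < e / 2 / (K + 1) by rewrite !divr_gt0// ltr_wpDl.
have /cvgrPdist_le /(_ _ epos) hz := znu.
near \oo => J.
have tail : K * (nu t - \sum_(j < J) `|z t j|) <= e / 2.
  have : `|nu t - \sum_(j < J) `|z t j| | <= e / 2 / (K + 1).
    by near: J.
  move=> /(le_trans (ler_norm _)); rewrite ler_pdivlMr ?ltr_wpDl//.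
  by have := mild_partial_le J t0; lra.
have head : (fun n => \sum_(j < J) `|\sum_(i < n) q j i t| * `|z t j|) @ \oo
    --> \sum_(j < J) `|0 : R| * `|z t j|.
  by apply: cvg_sumr => j; exact: (cvgM (cvg_norm (q0 j)) (cvg_cst _)).
rewrite big1 in head; last by move=> j _; rewrite normr0 mul0r.
have /cvgrPdist_le /(_ (e / 2) (divr_gt0 e0 (ltr0Sn _ 1))) hn := head.
near=> n; rewrite sub0r normrN (le_trans (bound J n))//.
rewrite [leRHS]splitr lerD//.
have : `|0 - \sum_(j < J) `|\sum_(i < n) q j i t| * `|z t j| | <= e / 2.
  by near: n.
by rewrite sub0r normrN; apply: le_trans; exact: ler_norm.
Unshelve. all: by end_near. Qed.

End theory.

(** Ergodicity applies the norm estimate to a difference of solutions. Its norm function is the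
    limit of monotone partial sums, which [nu1 + nu2] bounds. *)
Lemma mild_solution_sub q z1 f1 nu1 z2 f2 nu2 :
  mild_solution q z1 f1 nu1 -> mild_solution q z2 f2 nu2 ->
  exists nu, mild_solution q (fun t i => z1 t i - z2 t i)
    (fun t i => f1 t i - f2 t i) nu.
Proof.
move=> s1 s2; have [fi1 zE1 c1 n1 b1] := s1; have [fi2 zE2 c2 n2 b2] := s2.
have le t n : 0 <= t -> \sum_(j < n) `|z1 t j - z2 t j| <= nu1 t + nu2 t.
  move=> t0; apply: (@le_trans _ _ (\sum_(j < n) (`|z1 t j| + `|z2 t j|))).
    by apply: ler_sum => j _; exact: ler_normB.
  by rewrite big_split lerD// ?(mild_partial_le s1)// (mild_partial_le s2).
have cv t : 0 <= t -> cvgn (fun n => \sum_(j < n) `|z1 t j - z2 t j|).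
  move=> t0; apply: nondecreasing_is_cvgn.
    apply/nondecreasing_seqP => n.
    by rewrite big_ord_recr/= lerDl.
  by exists (nu1 t + nu2 t) => _ [n _ <-]; exact: le.
exists (fun t => limn (fun n => \sum_(j < n) `|z1 t j - z2 t j|)); split.
- move=> u i u0.
  by apply: integrable_EFinB => //; [exact: fi1|exact: fi2].
- move=> i t t0; rewrite RintegralB ?fi1 ?fi2// (zE1 i t)// (zE2 i t)//.
  ring.
- apply: ae_imply (ae_and c1 c2) => t [k1 k2] t0 i.
  have -> : (fun n => \sum_(j < n) q j i t * (z1 t j - z2 t j)) =
    (fun n => \sum_(j < n) q j i t * z1 t j - \sum_(j < n) q j i t * z2 t j).
    by apply/funext => n; rewrite -sumrB; apply: eq_bigr => j _; rewrite mulrBr.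
  by apply: cvgB; [exact: k1|exact: k2].
- by move=> t t0; exact: cv.
- move=> u u0; have [B1 B1P] := b1 _ u0; have [B2 B2P] := b2 _ u0.
  exists (B1 + B2) => t t0 tu.
  apply: (@le_trans _ _ (nu1 t + nu2 t)); last by rewrite lerD ?B1P ?B2P.
  by apply: limr_le; [exact: cv|apply: nearW => n; exact: le].
Qed.

End mild.

(** * The weighted norm estimate *)

Section exp_integral.
Context {R : realType}.
Notation leb := (@lebesgue_measure R).

Lemma exp_kernel_integral (b T : R) : 0 < b -> 0 <= T ->
  leb.-integrable `[0, T] (EFin \o (fun x => expR (- (b * (T - x))))) /\
  \int[leb]_(x in `[0, T]) expR (- (b * (T - x))) <= b^-1.
Proof.
move=> b0 T0.
have cE : continuous (fun x : R => expR (- (b * (T - x)))).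
  move=> x; apply: continuous_comp; last exact: continuous_expR.
  apply: continuousN; apply: continuousM; first exact: cst_continuous.
  by apply: continuousB => //; exact: cst_continuous.
split.
  apply: continuous_compact_integrable; first exact: segment_compact.
  exact: continuous_subspaceT.
(* The degenerate interval is set apart, since the fundamental theorem of calculus is applied for
   [0 < T]. *)
move: T0; rewrite le_eqVlt => /predU1P[<-|T0].
  by rewrite set_itv1 Rintegral_set1 invr_ge0 ltW.
pose F x : R := b^-1 * expR (- (b * (T - x))).
have dF (x : R) : is_derive x 1 F (expR (- (b * (T - x)))).
  rewrite /F; apply: is_derive_eq.
  rewrite /GRing.scale/=; field.
  by rewrite gt_eqF.
rewrite /Rintegral (@continuous_FTC2 _ _ F)//.
- rewrite /F subrr mulr0 oppr0 expR0 mulr1 -EFinB/= lerBlDr lerDl.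
  by rewrite mulr_ge0 ?expR_ge0// invr_ge0 ltW.
- exact: continuous_subspaceT.
- split.
  + by move=> x _; have [] := dF x.
  + apply: cvg_at_right_filter; apply: differentiable_continuous.
    by apply/derivable1_diffP; have [] := dF 0.
  + apply: cvg_at_left_filter; apply: differentiable_continuous.
    by apply/derivable1_diffP; have [] := dF T.
- by move=> x _; rewrite derive1E; have [_ ->] := dF x.
Qed.

End exp_integral.

Section core.
Context {R : realType}.
Notation leb := (@lebesgue_measure R).
Variables (lam mu : nat -> nat -> R -> R) (beta : nat -> R -> R)
  (q : nat -> nat -> R -> R).
Hypothesis q_def : queue_intensities lam mu beta q.
Hypothesis q_reg : standing_assumptions beta q.

(** The partial sums at [T] and at 0 differ by the integral of the partial sums of A z. These tend
    to 0 because the columns of A sum to 0, and they are dominated by a multiple of [opbound]. *)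
Lemma mild_mass_conserved z f nu (S0 T : R) : mild_solution q z f nu ->
  (fun n => \sum_(j < n) z 0 j) @ \oo --> S0 -> 0 <= T ->
  (fun n => \sum_(j < n) z T j) @ \oo --> S0.
Proof.
move=> sol z0 T0; have [fi zE fcv _ bnu] := sol.
have fi' (n : nat) (i : 'I_n) : leb.-integrable `[0, T] (EFin \o f ^~ i).
  exact: fi.
have E : (fun n => \sum_(j < n) z T j) = (fun n => \sum_(j < n) z 0 j +
    \int[leb]_(x in `[0, T]) (\sum_(i < n) 1 * f x i)).
  apply/funext => n.
  have [_ ->] := Rintegral_sum (index_enum 'I_n) (fun=> 1) (measurable_itv _)
    (@fi' n).
  by rewrite -big_split; apply: eq_bigr => i _; rewrite mul1r /= -zE.
rewrite E -[S0]addr0; apply: cvgD => //.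
have [B BP] := bnu _ T0.
apply: (@Rintegral_cvg0 _ _ _ (fun x => B * opbound q x)) => //.
- move=> n; apply: measurable_sum => i; apply: measurable_funM => //.
  by apply/measurable_EFinP; exact: (measurable_int leb (fi' n i)).
- by apply: integrable_EFinZl => //; exact: opbound_integrable q_reg _ T0.
- apply: ae_imply (ae_and fcv (column_norm_ae q_reg)) => x [xf KP].
  rewrite /= in_itv/= => /andP[x0 xT].
  have s1 n : \sum_(i < n) 1 * f x i = \sum_(i < n) f x i.
    by apply: eq_bigr => i _; rewrite mul1r.
  split=> [n|].
    rewrite s1 mulrC.
    apply: (le_trans (mild_image_partial_le sol n x0 (KP x0) (xf x0))).
    by rewrite ler_wpM2l ?opbound_ge0// BP.
  under eq_cvg do rewrite s1.
  apply: (mild_image_sum_cvg0 sol x0 (KP x0) _ (xf x0)) => j.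
  exact: (row_sum_cvg q_def x0).
Qed.

Variables (dk : nat -> R).
Hypothesis dk_pos : forall k, 0 < dk k.
Hypothesis dk_inf : 0 < inf (range dk).

Notation bss := (beta_sstar dk mu beta q).

Variables (Rss b : R).
Hypothesis Rss_pos : 0 < Rss.
Hypothesis b_pos : 0 < b.
Hypothesis decay : forall s t : R, 0 <= s <= t ->
  (expeR (- \int[leb]_(tau in `[s, t]) bss tau)
     <= (Rss * expR (- (b * (t - s))))%:E)%E.

Variables (z f : R -> nat -> R) (nu S : R -> R).
Hypothesis sol : mild_solution q z f nu.
Variables (M c W0 T : R).
Hypothesis M_pos : 0 < M.
Hypothesis c_ge0 : 0 <= c.
Hypothesis zS : forall t, 0 <= t -> (fun n => \sum_(j < n) z t j) @ \oo --> S t.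
Hypothesis Sc : {ae leb, forall t, 0 <= t -> beta_star beta t * `|S t| <= c}.
Hypothesis T_ge0 : 0 <= T.

Let w i := Num.min (dk i) M.
Hypothesis zW0 : forall n, \sum_(i < n) w i * `|z 0 i| <= W0.

(** For [x >= 0] this is the tail of the l_1-norm. The absolute value keeps it nonnegative at every
    real [x], as Gronwall's lemma requires of its error term. *)
Let rho n x := `|nu x - \sum_(j < n) `|z x j| |.

Let w_ge0 i : 0 <= w i.
Proof. by rewrite le_min !ltW. Qed.

Let rho_ge0 n x : 0 <= rho n x.
Proof. exact: normr_ge0. Qed.

Let rho_measurable n : measurable_fun `[0, T] (rho n).
Proof.
apply: measurableT_comp => //; apply: measurable_funB.
  exact: mild_norm_measurable sol _ T_ge0.
apply: measurable_sum => j; apply: measurableT_comp => //.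
exact: mild_measurable sol _ _ T_ge0.
Qed.

Let rho_le n x : 0 <= x -> rho n x <= nu x.
Proof.
move=> x0; rewrite /rho ger0_norm ?subr_ge0 ?(mild_partial_le sol)//.
by rewrite gerBl sumr_ge0.
Qed.

Let rhoK_integrable n :
  leb.-integrable `[0, T] (EFin \o (fun x => rho n x * opbound q x)).
Proof.
have [_ _ _ _ /(_ _ T_ge0)[B BP]] := sol.
have bd : [bounded rho n x | x in `[0, T]%classic].
  exists B; split; first exact: num_real.
  move=> y By x /=; rewrite in_itv/= => /andP[x0 xT].
  by rewrite normr_id (le_trans (rho_le n x0))// (le_trans (BP _ x0 xT))// ltW.
have mT : measurable (`[0, T]%classic : set R) by [].
exact: (@integrableMr _ _ R leb _ mT _ (EFin \o opbound q) (rho_measurable n)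
  bd (opbound_integrable q_reg T_ge0)).
Qed.

Let tail_cvg0 :
  (fun n => \int[leb]_(x in `[0, T]) (rho n x * opbound q x)) @ \oo --> (0 : R).
Proof.
have [_ _ _ znu /(_ _ T_ge0)[B BP]] := sol.
apply: (@Rintegral_cvg0 _ _ _ (fun x => B * opbound q x)) => //.
- by move=> n; apply/measurable_EFinP; exact: (measurable_int leb (rhoK_integrable n)).
- by apply: integrable_EFinZl => //; exact: opbound_integrable q_reg _ T_ge0.
- apply: aeW => x; rewrite /= in_itv/= => /andP[x0 xT]; split => [n|].
    rewrite ger0_norm ?mulr_ge0 ?opbound_ge0 ?rho_ge0//.
    by rewrite ler_wpM2r ?opbound_ge0// (le_trans (rho_le n x0))// BP.
  have L : (fun n => rho n x * opbound q x) @ \oo -->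
      `|nu x - nu x| * opbound q x.
    apply: cvgM; last exact: cvg_cst.
    by apply: cvg_norm; apply: cvgB; [exact: cvg_cst|exact: znu].
  by move: L; rewrite subrr normr0 mul0r; exact.
Qed.

Let g := fine \o bss.
Let G t := \int[leb]_(x in `[0, t]) g x.

Let g_integrable : leb.-integrable `[0, T] (EFin \o g).
Proof.
exact: (fine_beta_sstar_integrable q_def q_reg dk_pos dk_inf decay T_ge0).
Qed.

(** The two exponentials combine into that of minus the integral of [g] over [[x, T]], to which the
    decay hypothesis applies. *)
Let G_decay x : 0 <= x -> x <= T ->
  expR (- G T) * expR (G x) <= Rss * expR (- (b * (T - x))).
Proof.
move=> x0 xT; rewrite -expRD.
apply: le_trans
  (fine_decay q_def q_reg dk_pos dk_inf decay x0 xT).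
rewrite ler_expR /G (@Rintegral_itv_cat _ g 0 x T)// -[leRHS]/(- _).
by rewrite opprD addrAC addNr add0r.
Qed.

(** Gronwall's lemma for the first [n.+1] coordinates; the number is a successor because row 0,
    which carries the rank-one term, must be kept. *)
Let truncated_estimate n :
  \sum_(i < n.+1) w i * `|z T i| <= Rss * expR (- (b * T)) * W0 +
    Rss * w 0 * c / b +
    Rss * (2 * M) * \int[leb]_(x in `[0, T]) (rho n.+1 x * opbound q x).
Proof.
set N := n.+1.
have [fi zE fcv znu _] := sol.
pose eta x := w 0 * c + 2 * M * (rho N x * opbound q x).
(* The summands dominate in turn [g], the error, the coordinates of A z, and the weighted entries of
   the truncated matrix: [N] columns of norm at most [2 * opbound q x], with weights at most [M]. *)
pose m x := `|g x| + (eta x +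
  (\sum_(i < N) 1 * `|f x i| + N%:R * (M * 2) * opbound q x)).
have wc0 : 0 <= w 0 * c by rewrite mulr_ge0.
have M0 : 0 <= M by exact: ltW.
have rK0 x : 0 <= rho N x * opbound q x by rewrite mulr_ge0 ?opbound_ge0 ?rho_ge0.
have eta0 x : 0 <= eta x by rewrite addr_ge0// !mulr_ge0 ?opbound_ge0.
have sum0 x : 0 <= \sum_(i < N) 1 * `|f x i| by apply: sumr_ge0 => i _; rewrite mul1r.
have NK0 x : 0 <= N%:R * (M * 2) * opbound q x by rewrite !mulr_ge0 ?opbound_ge0.
have sN0 x : 0 <= \sum_(i < N) 1 * `|f x i| + N%:R * (M * 2) * opbound q x.
  exact: addr_ge0 (sum0 x) (NK0 x).
have ci k : leb.-integrable `[0, T] (EFin \o (fun=> k)).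
  apply: continuous_compact_integrable; first exact: segment_compact.
  by apply: continuous_subspaceT => x; exact: cvg_cst.
have ei : leb.-integrable `[0, T] (EFin \o eta).
  by apply: integrable_EFinD => //; apply: integrable_EFinZl.
have mi : leb.-integrable `[0, T] (EFin \o m).
  apply: integrable_EFinD => //; first exact: integrable_norm.
  apply: integrable_EFinD => //; apply: integrable_EFinD => //.
    have fi' (i : 'I_N) : leb.-integrable `[0, T] (EFin \o (fun x => `|f x i|)).
      by apply: integrable_norm; exact: fi.
    by have [] := Rintegral_sum (index_enum 'I_N) (fun=> 1) (measurable_itv _) fi'.
  by apply: integrable_EFinZl => //; exact: opbound_integrable q_reg _ T_ge0.
have [|||||||Ei HG] :=
  @cooperative_gronwall R N T w z f g eta m T_ge0 w_ge0 _ _ g_integrable ei mi.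
- by move=> i; exact: fi.
- by move=> i t t0 _; exact: zE.
- exact: eta0.
- by move=> x; rewrite lerDl; exact: addr_ge0 (eta0 x) (sN0 x).
- by move=> x; rewrite /m addrCA lerDl; exact: addr_ge0 (normr_ge0 _) (sN0 x).
- move=> x i iN; rewrite /m.
  have fs : `|f x i| <= \sum_(i < N) 1 * `|f x i|.
    rewrite (bigD1 (Ordinal iN))//= mul1r lerDl.
    by apply: sumr_ge0 => j _; rewrite mul1r.
  by have := normr_ge0 (g x); have := eta0 x; have := NK0 x; lra.
- apply: ae_imply (ae_and (ae_and fcv Sc) (ae_and (column_norm_ae q_reg)
    (beta_sstar_fin_num q_def q_reg dk_pos dk_inf decay T_ge0))).
  move=> x [[xf xS] [KP gE]] xT; have := xT; rewrite /= in_itv/= => /andP[x0 _].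
  have {}gE : ((g x)%:E <= bss x)%E by rewrite (gE xT).
  exists (a_star mu beta q x); split.
  + by move=> i j _ _; exact: (a_star_ge0 q_def x0).
  + move=> j jN.
    exact: (truncated_column_le q_def x0 dk_pos gE (KP x0) dk_inf M_pos jN).
  + apply: (@le_trans _ _ (N%:R * (M * 2) * opbound q x)).
      rewrite exchange_big/=.
      apply: (@le_trans _ _ (\sum_(j < N) M * (2 * opbound q x))).
        apply: ler_sum => j _.
        apply: (@le_trans _ _ (\sum_(i < N) M * `|a_star mu beta q x i j|)).
          by apply: ler_sum => i _; rewrite ler_wpM2r// ge_min lexx orbT.
        rewrite -mulr_sumr ler_wpM2l//.
        exact: (a_star_column_norm q_def x0 (KP x0)).
      by rewrite sumr_const card_ord -[leLHS]mulr_natl !mulrA.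
    by have := normr_ge0 (g x); have := eta0 x; have := sum0 x; rewrite /m; lra.
  + have wM i : 0 <= w i <= M by rewrite w_ge0 ge_min lexx orbT.
    apply: le_trans (truncation_error_le q_def x0 (KP x0) (ltn0Sn n) wM
      (znu _ x0) (zS x0) (xf x0) (xS x0)) _.
    rewrite lerD2l -[leLHS]mulrA ler_wpM2l ?mulr_ge0// mulrC.
    by rewrite ler_wpM2r ?opbound_ge0// ler_norm.
have {}HG := ler_wpM2l (expR_ge0 (- G T)) HG.
rewrite mulrA -expRD addNr expR0 mul1r mulrDr in HG.
apply: (le_trans HG); rewrite -addrA lerD//.
  apply: ler_pM => //.
  - by apply: sumr_ge0 => i _; rewrite mulr_ge0.
  - have := G_decay (lexx 0) T_ge0.
    by rewrite {2}/G set_itv1 Rintegral_set1 expR0 mulr1 subr0.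
have [expi expI] := exp_kernel_integral b_pos T_ge0.
rewrite -[leLHS]RintegralZl//.
apply: (@le_trans _ _ (\int[leb]_(x in `[0, T]) (Rss * w 0 * c *
    expR (- (b * (T - x))) + Rss * (2 * M) * (rho N x * opbound q x)))).
  apply: le_Rintegral => //.
  - exact: integrable_EFinZl.
  - by apply: integrable_EFinD => //; exact: integrable_EFinZl.
  move=> x; rewrite /= in_itv/= => /andP[x0 xT].
  rewrite mulrA /eta mulrDr lerD//.
    rewrite mulrC (le_trans (ler_wpM2l wc0 (G_decay x0 xT)))//.
    by rewrite mulrCA !mulrA.
  (* In the tail term the exponential is simply bounded by 1, as this term vanishes in the limit. *)
  rewrite -[leRHS]mulrA; apply: ler_wpM2r; first by rewrite !mulr_ge0 ?rho_ge0 ?opbound_ge0.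
  apply: (le_trans (G_decay x0 xT)).
  rewrite -[leRHS]mulr1; apply: ler_wpM2l; first exact: ltW.
  by rewrite -expR0 ler_expR oppr_le0 mulr_ge0 ?(ltW b_pos)// subr_ge0.
rewrite RintegralD//; [|exact: integrable_EFinZl|exact: integrable_EFinZl].
by rewrite !RintegralZl// lerD2r ler_wpM2l// !mulr_ge0// ltW.
Qed.

(** With [n] fixed the truncation index [k] grows: the sum over [k] coordinates dominates the one
    over [n], and the tail integral tends to 0. *)
Lemma weighted_norm_estimate n : \sum_(i < n) w i * `|z T i| <=
  Rss * expR (- (b * T)) * W0 + Rss * w 0 * c / b.
Proof.
have L : (fun k => Rss * expR (- (b * T)) * W0 + Rss * w 0 * c / b +
    Rss * (2 * M) * \int[leb]_(x in `[0, T]) (rho k x * opbound q x)) @ \oo -->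
    Rss * expR (- (b * T)) * W0 + Rss * w 0 * c / b + Rss * (2 * M) * 0.
  apply: cvgD; first exact: cvg_cst.
  by apply: cvgM; first exact: cvg_cst.
rewrite -[leRHS]addr0 -[X in _ + _ + X](mulr0 (Rss * (2 * M))).
apply: (cvgr_to_ge L); exists n.+1 => // -[//|k] /= nk.
apply: le_trans (truncated_estimate k).
rewrite -!(big_mkord xpredT (fun j => w j * `|z T j|)).
rewrite [leRHS](@big_cat_nat _ _ _ n)//=; last exact: ltnW.
by rewrite lerDl sumr_ge0// => i _; rewrite mulr_ge0.
Qed.

End core.

(** * Ergodicity and bounds for forward solutions *)

Section forward.
Context {R : realType}.
Notation leb := (@lebesgue_measure R).
Variables (lam mu : nat -> nat -> R -> R) (beta : nat -> R -> R)
  (q : nat -> nat -> R -> R).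
Hypothesis q_def : queue_intensities lam mu beta q.
Hypothesis q_reg : standing_assumptions beta q.

Lemma l1_norm_triangle (x y : nat -> R) :
  (l1_norm x <= l1_norm y + l1_norm (fun k => x k - y k)%R)%E.
Proof.
rewrite /l1_norm -nneseriesD; [|by move=> *; rewrite lee_fin..].
apply: lee_nneseries => [k _ _|k _]; first by rewrite lee_fin.
rewrite -EFinD lee_fin -{1}(subrKC (y k) (x k)).
exact: ler_normD.
Qed.

Lemma l1_norm_cvg (x : nat -> R) : (l1_norm x < +oo)%E ->
  (fun n => \sum_(j < n) `|x j|) @ \oo --> fine (l1_norm x).
Proof.
move=> xoo.
have xE : l1_norm x = (fine (l1_norm x))%:E.
  by rewrite fineK// ge0_fin_numE// l1_norm_ge0.
have : (fun n => \sum_(0 <= k < n) (`|x k|)%:E)%E @ \oo --> l1_norm x.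
  by apply: is_cvg_nneseries => k _ _; rewrite lee_fin.
rewrite xE => /fine_cvgP[_] H.
rewrite (_ : (fun n => _) = fine \o (fun n => \sum_(0 <= k < n) (`|x k|)%:E)%E)//.
by apply/funext => n /=; rewrite sumEFin/= big_mkord.
Qed.

(** By the reverse triangle inequality, continuity in l_1 makes the norm a continuous function of
    time, which attains its maximum on [[0, u]]. *)
Lemma forward_norm_bounded p u : forward_solution q 0 p -> 0 <= u ->
  exists B, forall t, 0 <= t -> t <= u -> fine (l1_norm (p t)) <= B.
Proof.
move=> [pfin pcont _] u0.
have nrmE (t : R) : 0 <= t -> l1_norm (p t) = (fine (l1_norm (p t)))%:E.
  by move=> t0; rewrite fineK// ge0_fin_numE ?pfin// l1_norm_ge0.
have cont : {within `[0, u], continuous (fun t => fine (l1_norm (p t)))}.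
  apply/subspace_continuousP => t0; rewrite /= in_itv/= => /andP[t00 _].
  have /fine_cvgP[finN cvN] := pcont _ t00.
  apply/cvgrPdist_le => e e0.
  have /cvgrPdist_le /(_ e e0) ce := cvN.
  move: finN ce; rewrite !near_withinE => finN ce.
  near=> t => /=.
  have dfin : 0 <= t -> l1_norm (fun k => p t k - p t0 k) \is a fin_num.
    by near: t.
  have dle : 0 <= t -> `|0 - fine (l1_norm (fun k => p t k - p t0 k))| <= e.
    by near: t.
  rewrite in_itv/= => /andP[tp _]; move: (dfin tp) (dle tp) => {}dfin.
  rewrite sub0r normrN /=.
  set D := l1_norm _ in dfin * => h3.
  have symD : l1_norm (fun k => p t0 k - p t k) = D.
    by apply: eq_eseriesr => k _; rewrite distrC.
  have := l1_norm_triangle (p t) (p t0); have := l1_norm_triangle (p t0) (p t).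
  rewrite symD -/D (nrmE _ tp) (nrmE _ t00) -(fineK dfin) -!EFinD !lee_fin.
  move=> h1 h2; have := le_trans (ler_norm _) h3 => h4.
  by rewrite /from_subspace ler_norml; apply/andP; split; lra.
have [c _ cP] := EVT_max u0 cont.
exists (fine (l1_norm (p c))) => t t0 tu.
by apply: cP; rewrite in_itv/= t0.
Unshelve. all: by end_near. Qed.

Lemma forward_mild p : forward_solution q 0 p ->
  mild_solution q p (fun t i => l1_apply (forward_op q t) (p t) i)
    (fun t => fine (l1_norm (p t))).
Proof.
move=> sol; have [pfin _ pE] := sol; split.
- by move=> u i u0; have [] := pE u i u0.
- by move=> i t t0; have [] := pE t i t0.
- apply: ae_imply (column_norm_ae q_reg) => t KP t0 i.
  (* The entries of A are bounded by the operator norm and [p t] is in l_1, so the limit in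
     [l1_apply] is a genuine sum. *)
  have cv : cvgn (series (fun j => forward_op q t i j * p t j)).
    apply: normed_cvg; apply: (@series_le_cvg _ _
      (fun j => opbound q t * `|p t j|)).
    + by move=> j; exact: normr_ge0.
    + by move=> j; rewrite mulr_ge0 ?opbound_ge0.
    + move=> j; rewrite /= normrM ler_wpM2r//.
      apply: le_trans (KP t0 j i.+1); rewrite big_ord_recr/= lerDr.
      exact: sumr_ge0.
    + apply: is_cvg_seriesZ; apply/cvg_ex; exists (fine (l1_norm (p t))).
      by under eq_cvg do rewrite seriesEord; apply: l1_norm_cvg; exact: pfin.
  by move: cv; rewrite /l1_apply seriesEord; exact.
- by move=> t t0; apply: l1_norm_cvg; exact: pfin.
- by move=> u u0; exact: forward_norm_bounded.
Qed.

Lemma prob_vector_partial_le (x : nat -> R) n : prob_vector x ->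
  \sum_(i < n) x i <= 1.
Proof.
move=> [x0 xs]; apply: (cvgr_to_ge xs); exists n => // m /= nm.
rewrite seriesEord/= -!(big_mkord xpredT x) [leRHS](@big_cat_nat _ _ _ n)//=.
rewrite lerDl.
exact: sumr_ge0.
Qed.

Variables (dk : nat -> R).
Hypothesis dk_pos : forall k, 0 < dk k.
Hypothesis dk_inf : 0 < inf (range dk).

Notation bss := (beta_sstar dk mu beta q).

Variables (Rss b : R).
Hypothesis Rss_pos : 0 < Rss.
Hypothesis b_pos : 0 < b.
Hypothesis decay : forall s t : R, 0 <= s <= t ->
  (expeR (- \int[leb]_(tau in `[s, t]) bss tau)
     <= (Rss * expR (- (b * (t - s))))%:E)%E.

Lemma queue_exp_weakly_ergodic : exp_weakly_ergodic q.
Proof.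
(* The factor 2 bounds the l_1-distance of two probability vectors. *)
move=> p1 p2 s1 P1 s2 P2; exists (2 * Rss), b; split => //; first exact: mulr_gt0.
move=> T T0.
have [nu sol] := mild_solution_sub (forward_mild s1) (forward_mild s2).
set z := fun t i => _ in sol.
have z0 : (fun n => \sum_(j < n) z 0 j) @ \oo --> (0 : R).
  have [_ h1] := P1; have [_ h2] := P2.
  have -> : (fun n => \sum_(j < n) z 0 j) = series (p1 0) \- series (p2 0).
    by apply/funext => n /=; rewrite !seriesEord -sumrB.
  by have := cvgB h1 h2; rewrite subrr; exact.
have zS t : 0 <= t -> (fun n => \sum_(j < n) z t j) @ \oo --> (0 : R).
  exact: (mild_mass_conserved q_def q_reg sol z0).
have Sc : {ae leb, forall t, 0 <= t -> beta_star beta t * `|0 : R| <= 0}.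
  by apply: aeW => t _; rewrite normr0 mulr0.
(* Truncating at the level [d] makes all the weights equal to [d], so the weighted norm is [d] times
   the l_1-norm. *)
pose d := inf (range dk).
have wd i : Num.min (dk i) d = d by apply/min_idPr; exact: dk_ge_inf.
have zW n : \sum_(i < n) Num.min (dk i) d * `|z 0 i| <= d * 2.
  under eq_bigr do rewrite wd.
  rewrite -mulr_sumr ler_wpM2l ?(ltW dk_inf)//.
  apply: (@le_trans _ _ (\sum_(i < n) (p1 0 i + p2 0 i))).
    apply: ler_sum => i _; rewrite (le_trans (ler_normB _ _))// !ger0_norm//.
      by have [] := P2.
    by have [] := P1.
  rewrite big_split/= (_ : 2 = 1 + 1 :> R)//.
  by rewrite lerD// prob_vector_partial_le.
have main := weighted_norm_estimate q_def q_reg dk_pos dk_inf Rss_pos b_pos decay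
  sol dk_inf (lexx 0) zS Sc T0 zW.
apply: lime_le; first by apply: is_cvg_nneseries => k _ _; rewrite lee_fin.
apply: nearW => n; rewrite big_mkord sumEFin lee_fin.
have := main n; under eq_bigr do rewrite wd.
rewrite mulr0 mul0r addr0 -mulr_sumr => H.
rewrite -(ler_pM2l dk_inf) (le_trans H)// le_eqVlt; apply/orP; left; apply/eqP.
by rewrite -/d; ring.
Qed.

(** Since beta_* is nonnegative, a negative bound would fail on all of [[0, 1]], which is not a null
    set. *)
Lemma bstar_ge0 (bstar : R) :
  {ae leb, forall t, 0 <= t -> beta_star beta t <= bstar} -> 0 <= bstar.
Proof.
move=> H; rewrite leNgt; apply/negP => b0.
have [A [mA A0 sA]] : leb.-negligible `[0, 1]%classic.
  apply: negligibleS H => t; rewrite /= in_itv/= => /andP[t0 _] /(_ t0).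
  by rewrite leNgt (lt_le_trans b0)// (beta_star_ge0 q_def t0).
have : (leb `[0%R, 1%R]%classic <= leb A)%E.
  by apply: le_measure; rewrite ?inE.
by rewrite A0 lebesgue_measure_itv/= lte_fin ltr01 oppr0 adde0 lee_fin ler10.
Qed.

(** The solution starts from the unit mass at [i], whose weighted norm is [dk i]; the mass stays 1,
    so [bstar] bounds beta_* times the mass. *)
Lemma forward_weighted_bound p (bstar t : R) i n : forward_solution q 0 p ->
  (forall t, 0 <= t -> prob_vector (p t)) -> (forall j, p 0 j = (i == j)%:R) ->
  {ae leb, forall t, 0 <= t -> beta_star beta t <= bstar} -> 0 <= t ->
  \sum_(j < n) dk j * p t j <=
    Rss * expR (- (b * t)) * dk i + Rss * dk 0%N * bstar / b.
Proof.
move=> sol pp p0 bb t0; have bs0 := bstar_ge0 bb.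
(* This level exceeds the first [n] weights, so truncation does not alter them; the term [dk 0]
   keeps it positive when [n] is 0. *)
pose M := dk 0%N + \sum_(j < n) dk j.
have M0 : 0 < M by rewrite ltr_wpDr// sumr_ge0// => j _; exact: ltW.
have wM j : (j < n)%N -> Num.min (dk j) M = dk j.
  move=> jn; apply/min_idPl; rewrite /M (bigD1 (Ordinal jn))//= addrCA lerDl.
  by rewrite addr_ge0 ?(ltW (dk_pos _))// sumr_ge0// => k _; exact: ltW.
have zS s : 0 <= s -> (fun n => \sum_(j < n) p s j) @ \oo --> (1 : R).
  by move=> s0; have [_] := pp s s0; rewrite seriesEord.
have Sc : {ae leb, forall s, 0 <= s -> beta_star beta s * `|1 : R| <= bstar}.
  by apply: ae_imply bb => s H s0; rewrite normr1 mulr1 H.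
have zW m : \sum_(j < m) Num.min (dk j) M * `|p 0 j| <= dk i.
  have [im|mi] := ltnP i m; last first.
    rewrite big1 ?(ltW (dk_pos _))// => j _.
    by rewrite p0 gtn_eqF ?normr0 ?mulr0// (leq_trans (ltn_ord j)).
  rewrite (bigD1 (Ordinal im))//= big1 ?addr0.
    by rewrite p0 eqxx normr1 mulr1 ge_min lexx.
  move=> j ji; rewrite p0 eq_sym (negbTE (_ : (j : nat) != i)) ?normr0 ?mulr0//.
have main := weighted_norm_estimate q_def q_reg dk_pos dk_inf Rss_pos b_pos decay
  (forward_mild sol) M0 bs0 zS Sc t0 zW n.
apply: (@le_trans _ _ (\sum_(j < n) Num.min (dk j) M * `|p t j|)).
  apply: ler_sum => j _; rewrite wM// ger0_norm//.
  by have [] := pp t t0.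
apply: (le_trans main); rewrite lerD2l ler_wpM2r ?invr_ge0 ?(ltW b_pos)//.
rewrite ler_wpM2r// ler_wpM2l ?(ltW Rss_pos)// ge_min lexx//.
Qed.

End forward.

(** * Total probability and the bound for the chain *)

Section chain.
Context {R : realType} (dsp : measure_display) (T : measurableType dsp)
  (P : probability T R) (X : R -> {RV P >-> nat}).
Variable Pi : R -> R -> nat -> nat -> R.
Hypothesis chain : forall (n : nat) (t : nat -> R) (i : nat -> nat),
  0 <= t 0%N -> (forall k, (k <= n)%N -> t k < t k.+1) ->
  P (\bigcap_(k in [set k | (k <= n.+1)%N]) (X (t k) @^-1` [set i k])) =
  (P (\bigcap_(k in [set k | (k <= n)%N]) (X (t k) @^-1` [set i k])) *
   (Pi (t n) (t n.+1) (i n) (i n.+1))%:E)%E.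

Lemma measurable_state (t : R) j : measurable (X t @^-1` [set j]).
Proof. by rewrite -[_ @^-1` _]setTI; exact: measurable_funP. Qed.

Lemma state_probE (t : R) j : (state_prob X t j)%:E = P (X t @^-1` [set j]).
Proof. by rewrite fineK// fin_num_measure//; exact: measurable_state. Qed.

(** The event is split according to the state at time 0, and the Markov property is applied to the
    two times 0 and [t]; they must be distinct, hence [0 < t]. *)
Lemma state_prob_total (t : R) j : 0 < t ->
  ((state_prob X t j)%:E =
    \sum_(0 <= i <oo) (state_prob X 0 i * Pi 0 t i j)%R%:E)%E.
Proof.
move=> t0; rewrite state_probE.
have -> : X t @^-1` [set j] =
    \bigcup_i (X 0 @^-1` [set i] `&` X t @^-1` [set j]).
  apply/seteqP; split => [x xj|x [i _ []]//].
  by exists (X 0 x).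
have mA i : measurable (X 0 @^-1` [set i] `&` X t @^-1` [set j]).
  by apply: measurableI; exact: measurable_state.
rewrite measure_semi_bigcup//; last 2 first.
- by move=> i k _ _ [x [[<- _] [<- _]]].
- exact: bigcup_measurable.
apply: eq_eseriesr => i _.
pose tt (k : nat) := if k is 0 then 0 else t.
pose ii (k : nat) := if k is 0 then i else j.
have E0 : \bigcap_(k in [set k | (k <= 0)%N]) (X (tt k) @^-1` [set ii k]) =
    X 0 @^-1` [set i].
  by apply/seteqP; split => [x /(_ 0%N)|x x0 [|//] _]; exact.
have E1 : \bigcap_(k in [set k | (k <= 1)%N]) (X (tt k) @^-1` [set ii k]) =
    X 0 @^-1` [set i] `&` X t @^-1` [set j].
  apply/seteqP; split => [x H|x [x0 xt] [|[|//]] _//].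
  by split; [exact: (H 0%N)|exact: (H 1%N)].
have H : forall k, (k <= 0)%N -> tt k < tt k.+1 by case.
have := chain ii (lexx 0 : 0 <= tt 0%N) H.
by rewrite E1 E0 EFinM state_probE.
Qed.

End chain.

Theorem theorem2 (R : realType) (dsp : measure_display)
    (T : measurableType dsp) (P : probability T R) (X : R -> {RV P >-> nat})
    (lam mu : nat -> nat -> R -> R) (beta : nat -> R -> R)
    (q : nat -> nat -> R -> R)
    (q_def : queue_intensities lam mu beta q)
    (q_reg : standing_assumptions beta q)
    (X_chain : markov_chain_with_intensities X q)
    (dk : nat -> R) (dk_pos : forall k, 0 < dk k)
    (dk_inf : 0 < inf (range dk))
    (Rss bss : R) (Rss_pos : 0 < Rss) (bss_pos : 0 < bss)
    (decay : forall s t : R, 0 <= s <= t ->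
      (expeR (- \int[@lebesgue_measure R]_(tau in `[s, t])
                   beta_sstar dk mu beta q tau)
        <= (Rss * expR (- (bss * (t - s))))%:E)%E)
    (bstar : R)
    (beta_bounded : {ae @lebesgue_measure R, forall t,
      0 <= t -> beta_star beta t <= bstar}) :
  exp_weakly_ergodic q /\
  ((l1D_norm dk (state_prob X 0) < +oo)%E ->
   (limf_esup (fun t => l1D_norm dk (state_prob X t)) (pinfty_nbhs R)
     <= (Rss * dk 0%N * bstar / bss)%:E)%E).
Proof.
split; first exact: (queue_exp_weakly_ergodic q_def q_reg dk_pos dk_inf Rss_pos bss_pos
  decay).
move=> D0fin; have [Pi [Pi_prob chain Pi_sol]] := X_chain.
have bs0 := bstar_ge0 q_def beta_bounded.
pose r : R := Rss * dk 0%N * bstar / bss.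
have r0 : 0 <= r by rewrite divr_ge0 ?mulr_ge0// ltW.
have sp0 s i : 0 <= state_prob X s i by rewrite fine_ge0.
pose D := fine (l1D_norm dk (state_prob X 0)).
have D_ge0 : 0 <= D by rewrite fine_ge0// l1_norm_ge0.
have DE : (\sum_(0 <= i <oo) (dk i * state_prob X 0 i)%:E)%E = D%:E.
  rewrite fineK ?ge0_fin_numE ?l1_norm_ge0//.
  by apply: eq_eseriesr => i _; rewrite ger0_norm// mulr_ge0// ltW.
have S1 : (\sum_(0 <= i <oo) (state_prob X 0 i)%:E)%E = 1%E.
  under eq_eseriesr do rewrite state_probE.
  rewrite -measure_semi_bigcup.
  - rewrite (_ : \bigcup_n (X 0 @^-1` [set n]) = setT); first exact: probability_setT.
    by apply/seteqP; split => // x _; exists (X 0 x).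
  - by move=> i; exact: measurable_state.
  - by move=> i k _ _ [x [<- <-]].
  - by apply: bigcup_measurable => i _; exact: measurable_state.
(* The forward system is given for the rows of [Pi], so the estimate is used for each deterministic
   start [i] and averaged over the initial law: the weights [dk i] average to [D], the constant term
   to [r]. *)
have bound t : 0 < t ->
    (l1D_norm dk (state_prob X t) <= (Rss * expR (- (bss * t)) * D + r)%:E)%E.
  move=> t0; have t0' := ltW t0.
  have Pi_ge0 i j : 0 <= Pi 0 t i j.
    by have [] := Pi_prob 0 t i; rewrite ?lexx ?t0'.
  apply: lime_le; first by apply: is_cvg_nneseries => k _ _; rewrite lee_fin.
  apply: nearW => n; rewrite big_mkord.
  rewrite (eq_bigr (fun j : 'I_n => \sum_(0 <= i <oo)
      (dk j * (state_prob X 0 i * Pi 0 t i j))%:E)%E); last first.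
    move=> j _; rewrite ger0_norm; last by rewrite mulr_ge0// ltW.
    rewrite EFinM (state_prob_total chain)// -nneseriesZl.
      by apply: eq_eseriesr => i _; rewrite EFinM.
    by move=> i _; rewrite lee_fin mulr_ge0.
  rewrite -nneseries_sum; last first.
    by move=> j i _; rewrite lee_fin !mulr_ge0// ltW.
  apply: (@le_trans _ _ (\sum_(0 <= i <oo)
      ((Rss * expR (- (bss * t)))%:E * (dk i * state_prob X 0 i)%:E +
       r%:E * (state_prob X 0 i)%:E))%E).
    apply: lee_nneseries => [i _ _|i _].
      by rewrite sume_ge0// => j _; rewrite lee_fin !mulr_ge0// ltW.
    rewrite sumEFin -!EFinM -EFinD lee_fin.
    have [sol init] := Pi_sol 0 i (lexx 0).
    have pp s : 0 <= s -> prob_vector (Pi 0 s i).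
      by move=> s0; apply: Pi_prob; rewrite lexx.
    have := forward_weighted_bound q_def q_reg dk_pos dk_inf Rss_pos bss_pos
      decay n sol pp init beta_bounded t0'.
    move=> /(ler_wpM2l (sp0 0 i)); rewrite mulr_sumr -/r.
    under eq_bigr do rewrite mulrCA.
    by move=> /le_trans; apply; rewrite le_eqVlt; apply/orP; left; apply/eqP; ring.
  rewrite nneseriesD; last 2 first.
  - by move=> i _ _; rewrite -EFinM lee_fin !mulr_ge0 ?expR_ge0// ltW.
  - by move=> i _ _; rewrite -EFinM lee_fin mulr_ge0.
  rewrite nneseriesZl; last by move=> i _; rewrite lee_fin mulr_ge0// ltW.
  rewrite nneseriesZl; last by move=> i _; rewrite lee_fin.
  by rewrite DE S1 mule1 -EFinM -EFinD.
rewrite -/r; apply/lee_addgt0Pr => e e0.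
(* Beyond this time the transient term is at most [e], because [expR (bss * t)] is at least
   [1 + bss * t]. *)
pose A : R := Rss * D / (e * bss).
have A0 : 0 <= A by rewrite divr_ge0 ?mulr_ge0// ltW.
apply: (@le_trans _ _
    (ereal_sup ((fun t => l1D_norm dk (state_prob X t)) @` [set t | A < t]))).
  apply: ereal_inf_lbound; exists [set t | A < t] => //.
  by exists A; split; first exact: num_real.
apply: ge_ereal_sup => _ [t /= At <-].
have t0 : 0 < t by exact: le_lt_trans At.
apply: (le_trans (bound t t0)); rewrite -EFinD lee_fin addrC lerD2l.
have := expR_ge1Dx (bss * t); rewrite expRN mulrAC ler_pdivrMr ?expR_gt0//.
move: At; rewrite ltr_pdivrMr ?mulr_gt0// => At.
move=> /(ler_wpM2l (ltW e0)); apply: le_trans.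
have -> : e * (1 + bss * t) = e + t * (e * bss) by ring.
by rewrite (le_trans (ltW At))// lerDr ltW.
Qed.
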